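(* Let $\alpha,\beta,\gamma$ be real numbers with $0<\beta^2<\alpha^2$, $\alpha,\beta>0$ and $\gamma>0$. There exist constants $C_L^{\mathbf c}>0$ and $C_M^{\mathbf c}>0$ depending only on $\alpha,\beta,\gamma$ such that the following holds. Consider a parametric linear system with data $p,N,d\in\mathbb N$, $\mathcal D\subset\mathbb R^p$, $A_\mu\in\mathbb R^{N\times N}$ and $(\mathbf f_\mu^T,\mathbf g_\mu^T)^T\in\mathbb R^N$ for $\mu\in\mathcal D$, and a set $\mathcal V\subset\mathbb R^{N\times d}$ of possible reduced bases, as described in the context, and suppose that Assumptions 1, 2 and 3 listed in the context hold. For any $\varepsilon\in(0,1/4)$ and any possible reduced basis $V\in\mathcal V$, set $B_\mu=A_\mu V$, let $$\mathbf c_\mu=\left(B_\mu^TB_\mu\right)^{-1}B_\mu^T\begin{bmatrix}\mathbf f_\mu\\ \mathbf g_\mu\end{bmatrix}\in\mathbb R^d ,\qquad \mu\in\mathcal D,$$ and define $$\varepsilon_1:=\min\left\{\frac{\varepsilon\beta^2}{12\gamma},\frac{\beta\sqrt{\varepsilon}}{4},\frac{\alpha}{4},\frac{\sqrt{\alpha\gamma}}{2}\right\},\qquad \varepsilon_2:=\min\left\{\frac{\varepsilon\beta^2}{12\alpha},\frac{\beta\sqrt{\varepsilon}}{4},\frac{\gamma}{4},\frac{\sqrt{\alpha\gamma}}{2}\right\},$$ $$\varepsilon_3:=\min\left\{\frac{\varepsilon\beta^4}{144\alpha^2\gamma},\frac{\beta^2\sqrt{6\alpha\gamma\varepsilon}}{24\alpha\gamma},\frac{\beta^2}{12\alpha},\frac{\beta}{3}\right\}.$$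 Then there exists a ReLU neural network $\Phi_{\mathrm{para};\varepsilon}^{\mathbf c}$ with $p$-dimensional input and $d$-dimensional output such that: 1. $\displaystyle\sup_{\mu\in\mathcal D}\left\|\mathbf c_\mu-R\left(\Phi_{\mathrm{para};\varepsilon}^{\mathbf c}\right)(\mu)\right\|_2\le\varepsilon.$ 2. The number of layers satisfies $$\begin{aligned}L(\Phi_{\mathrm{para};\varepsilon}^{\mathbf c})\le{}& C_L^{\mathbf c}\cdot\log_2(\log_2(1/\varepsilon))\cdot(\log_2(1/\varepsilon)+\log_2 d)\\&+C_L^{\mathbf c}\log_2N+L(B;V,\varepsilon_1)+L(B;V,\varepsilon_3)+L(\mathbf{fg};\varepsilon_2).\end{aligned}$$ 3. The number of non-zero parameters satisfies $$\begin{aligned}M(\Phi_{\mathrm{para};\varepsilon}^{\mathbf c})\le{}& C_M^{\mathbf c}Nd^2\cdot(\log_2(1/\varepsilon)+\log_2N)\\&+C_M^{\mathbf c}d^2\log_2(1/\varepsilon)\cdot(\log_2(\log_2(1/\varepsilon))+d)\cdot(\log_2(1/\varepsilon)+\log_2d)\\&+C_M^{\mathbf c}d^2\cdot\log_2(\log_2(1/\varepsilon))\cdot\log_2N\\&+16M(B;V,\varepsilon_1)+16M(\mathbf{fg};\varepsilon_2)+8M(B;V,\varepsilon_3)\\&+80NdL(B;V,\varepsilon_1)+80NdL(\mathbf{fg};\varepsilon_2)+16d^2L(B;V,\varepsilon_3).\end{aligned}$$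
   Context: Neural networks. A neural network $\Phi$ with input dimension $n_0\in\mathbb N$ and $L=L(\Phi)\in\mathbb N$ layers is a sequence $\Phi=((W_1,b_1),\dots,(W_L,b_L))$ with $W_i\in\mathbb R^{n_i\times n_{i-1}}$, $b_i\in\mathbb R^{n_i}$, $n_i\in\mathbb N$; its output dimension is $n_L$. With the ReLU activation $\sigma(x)=\max\{0,x\}$ applied entrywise, its realization $R(\Phi):\mathbb R^{n_0}\to\mathbb R^{n_L}$ is $R(\Phi)(x)=x_L$, where $x_0:=x$, $x_i:=\sigma(W_ix_{i-1}+b_i)$ for $i=1,\dots,L-1$, and $x_L:=W_Lx_{L-1}+b_L$. The number of non-zero parameters is $M(\Phi):=\sum_{i=1}^L(\|W_i\|_0+\|b_i\|_0)$, where $\|\cdot\|_0$ counts non-zero entries. ''ReLU neural network'' means a neural network in this sense. $\mathbb N=\{1,2,\dots\}$. Notation. $\|\cdot\|_2$ is the Euclidean norm on vectors and the spectral norm on matrices. For $A\in\mathbb R^{n\times k}$, $\mathrm{vec}(A)\in\mathbb R^{nk}$ is the column-by-column stacking of $A$, and $\mathrm{matr}$ is the inverse operation, turning a vector in $\mathbb R^{nk}$ into an $n\times k$ matrix (dimensions clear from the context). Setting. $\mathcal D\subset\mathbb R^p$ is a parameter set. For each $\mu\in\mathcal D$ there are a matrix $A_\mu\in\mathbb R^{N\times N}$ and a right-hand side vector $(\mathbf f_\mu^T,\mathbf g_\mu^T)^T\in\mathbb R^N$ (the collocation discretization of a linear parametric PDE and its boundary condition on $N$ nodes). A reduced basis is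 a matrix $V\in\mathbb R^{N\times d}$ whose $d$ columns form an orthogonal system; $\mathcal V$ denotes the set of possible reduced bases under consideration. For $V\in\mathcal V$, put $B_\mu:=A_\mu V\in\mathbb R^{N\times d}$. Assumption 1. For all $\mu\in\mathcal D$ and all $V\in\mathcal V$, the spectrum of $B_\mu^TB_\mu$ is contained in $[\beta^2,\alpha^2]$, and $\|(\mathbf f_\mu^T,\mathbf g_\mu^T)^T\|_2\le\gamma$ for all $\mu\in\mathcal D$. Assumption 2. For any $\varepsilon>0$ and $V\in\mathcal V$ there is a ReLU neural network $\Phi_{V,\varepsilon}^B$ with $p$-dimensional input and $Nd$-dimensional output such that $\sup_{\mu\in\mathcal D}\|B_\mu-\mathrm{matr}(R(\Phi_{V,\varepsilon}^B)(\mu))\|_2\le\varepsilon$. (Permuting the outputs gives a ReLU neural network $\Phi_{V,\varepsilon}^{B^T}$ with $\sup_{\mu\in\mathcal D}\|B_\mu^T-\mathrm{matr}(R(\Phi_{V,\varepsilon}^{B^T})(\mu))\|_2\le\varepsilon$ and the same number of layers and of non-zero parameters.) Such networks are fixed, and $L(B;V,\varepsilon):=L(\Phi_{V,\varepsilon}^B)=L(\Phi_{V,\varepsilon}^{B^T})$, $M(B;V,\varepsilon):=M(\Phi_{V,\varepsilon}^B)=M(\Phi_{V,\varepsilon}^{B^T})$. Assumption 3. For any $\varepsilon>0$ there is a ReLU neural network $\Phi_\varepsilon^{\mathbf{fg}}$ with $p$-dimensional input and $N$-dimensional output such that $\sup_{\mu\in\mathcal D}\|(\mathbf f_\mu^T,\mathbf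 g_\mu^T)^T-R(\Phi_\varepsilon^{\mathbf{fg}})(\mu)\|_2\le\varepsilon$. Such networks are fixed, and $L(\mathbf{fg};\varepsilon):=L(\Phi_\varepsilon^{\mathbf{fg}})$, $M(\mathbf{fg};\varepsilon):=M(\Phi_\varepsilon^{\mathbf{fg}})$. *)

(* Defs.v *)
From HB Require Import structures.
From mathcomp Require Import all_boot all_order all_algebra.
From mathcomp Require Import boolp classical_sets set_interval reals.
From mathcomp Require Import constructive_ereal ereal exp.

Set Implicit Arguments.
Unset Strict Implicit.
Unset Printing Implicit Defensive.

Import Order.TTheory GRing.Theory Num.Theory.
Local Open Scope classical_set_scope.
Local Open Scope ring_scope.

(* The networks ((W_1, b_1), ..., (W_L, b_L)), listed from the input layer to
   the output layer, with input dimension n and output dimension m.  A sequence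
   is nonempty by construction (L >= 1) and all hidden widths are positive;
   positivity of n and m is left to the context. *)
Inductive network (R : Type) : nat -> nat -> Type :=
| OutputLayer (n m : nat) (W : 'M[R]_(m, n)) (b : 'cV[R]_m) : network R n m
| HiddenLayer (n k m : nat) (W : 'M[R]_(k, n)) (b : 'cV[R]_k) (hk : (0 < k)%N)
    (Phi : network R k m) : network R n m.

Section Networks.
Variable R : realType.

Definition relu (n : nat) (x : 'cV[R]_n) : 'cV[R]_n :=
  map_mx (fun t => Num.max 0 t) x.

Fixpoint realization (n m : nat) (Phi : network R n m) :
    'cV[R]_n -> 'cV[R]_m :=
  match Phi with
  | OutputLayer _ _ W b => fun x => W *m x + b
  | HiddenLayer _ _ _ W b _ Psi => fun x => realization Psi (relu (W *m x + b))
  end.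

Fixpoint layers (n m : nat) (Phi : network R n m) : nat :=
  match Phi with
  | OutputLayer _ _ _ _ => 1%N
  | HiddenLayer _ _ _ _ _ _ Psi => (layers Psi).+1
  end.

Definition nnz (m n : nat) (A : 'M[R]_(m, n)) : nat :=
  (\sum_(i < m) \sum_(j < n) (A i j != 0%R))%N.

Fixpoint weights (n m : nat) (Phi : network R n m) : nat :=
  match Phi with
  | OutputLayer _ _ W b => (nnz W + nnz b)%N
  | HiddenLayer _ _ _ W b _ Psi => (nnz W + nnz b + weights Psi)%N
  end.

End Networks.

Section LinearAlgebra.
Variable R : realType.

Definition norm2 (n : nat) (x : 'cV[R]_n) : R :=
  Num.sqrt (\sum_(i < n) x i 0 ^+ 2).

(* The spectral norm, as the operator norm induced by the Euclidean norms. *)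
Definition mxnorm2 (m n : nat) (A : 'M[R]_(m, n)) : R :=
  sup [set norm2 (A *m x) | x in [set x : 'cV[R]_n | norm2 x <= 1]].

(* Real eigenvalues only: this is the whole spectrum for the symmetric matrices
   to which it is applied. *)
Definition spectrum (n : nat) (A : 'M[R]_n) : set R :=
  [set a | eigenvalue A a].

Definition orthogonal_system (N d : nat) (V : 'M[R]_(N, d)) : Prop :=
  forall i j : 'I_d, i != j -> (col i V)^T *m col j V = 0.

(* The inverse of column-by-column stacking.  As vec_mx is row-major, the d
   successive blocks of length N in v are read as the rows of a d x N matrix,
   which is then transposed. *)
Definition matr (N d : nat) (v : 'cV[R]_(d * N)) : 'M[R]_(N, d) :=
  (vec_mx v^T)^T.

End LinearAlgebra.

Section Constants.
Variable R : realType.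

Definition log2 (x : R) : R := ln x / ln 2.

Definition eps1 (alpha beta gamma e : R) : R :=
  Num.min (e * beta ^+ 2 / (12 * gamma))
    (Num.min (beta * Num.sqrt e / 4)
      (Num.min (alpha / 4) (Num.sqrt (alpha * gamma) / 2))).

Definition eps2 (alpha beta gamma e : R) : R :=
  Num.min (e * beta ^+ 2 / (12 * alpha))
    (Num.min (beta * Num.sqrt e / 4)
      (Num.min (gamma / 4) (Num.sqrt (alpha * gamma) / 2))).

Definition eps3 (alpha beta gamma e : R) : R :=
  Num.min (e * beta ^+ 4 / (144 * alpha ^+ 2 * gamma))
    (Num.min
      (beta ^+ 2 * Num.sqrt (6 * alpha * gamma * e) / (24 * alpha * gamma))
      (Num.min (beta ^+ 2 / (12 * alpha)) (beta / 3))).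

End Constants.

Section ReducedSystem.
Variables (R : realType) (p N d : nat).

Definition Bmat (A : 'cV[R]_p -> 'M[R]_N) (V : 'M[R]_(N, d)) (mu : 'cV[R]_p) :
  'M[R]_(N, d) := A mu *m V.

(* fg mu is the stacked right-hand side of the full system. *)
Definition cvec (A : 'cV[R]_p -> 'M[R]_N) (fg : 'cV[R]_p -> 'cV[R]_N)
    (V : 'M[R]_(N, d)) (mu : 'cV[R]_p) : 'cV[R]_d :=
  let B := Bmat A V mu in invmx (B^T *m B) *m B^T *m fg mu.

Definition assumption1 (alpha beta gamma : R) (D : set 'cV[R]_p)
    (A : 'cV[R]_p -> 'M[R]_N) (fg : 'cV[R]_p -> 'cV[R]_N)
    (VV : set 'M[R]_(N, d)) : Prop :=
  (forall mu V, D mu -> VV V ->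
     spectrum ((Bmat A V mu)^T *m Bmat A V mu)
       `<=` `[beta ^+ 2, alpha ^+ 2]%classic) /\
  (forall mu, D mu -> norm2 (fg mu) <= gamma).

(* In the next two predicates PhiB and Phifg are the fixed choices of
   approximating networks, as functions of the basis and the accuracy. *)
Definition assumption2 (D : set 'cV[R]_p) (A : 'cV[R]_p -> 'M[R]_N)
    (VV : set 'M[R]_(N, d))
    (PhiB : 'M[R]_(N, d) -> R -> network R p (d * N)) : Prop :=
  forall (e : R) (V : 'M[R]_(N, d)), 0 < e -> VV V ->
    (ereal_sup [set (mxnorm2 (Bmat A V mu
                              - matr (realization (PhiB V e) mu)))%:E
               | mu in D] <= e%:E)%E.

Definition assumption3 (D : set 'cV[R]_p) (fg : 'cV[R]_p -> 'cV[R]_N)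
    (Phifg : R -> network R p N) : Prop :=
  forall e : R, 0 < e ->
    (ereal_sup [set (norm2 (fg mu - realization (Phifg e) mu))%:E
               | mu in D] <= e%:E)%E.

End ReducedSystem.

(* Main.v *)
Require Import Defs.
From mathcomp Require Import all_boot all_order all_algebra.
From mathcomp Require Import boolp classical_sets set_interval reals.
From mathcomp Require Import constructive_ereal ereal exp.
From mathcomp Require Import complex spectral sesquilinear ring lra zify.

(** The coefficients c solve the normal equations (B^T B) c = B^T f, and the
network carries out a numerical solution of these equations, every product of
two numbers being replaced by a small ReLU network.

Products.  By polarization a product is a difference of two squares, and
x^2 = |x| - 1/4 + (2|x| - 1)^2 / 4 reduces the square of a number of [-1, 1]
to the square of another one at a quarter of the weight.  Hence q hidden layers
of constant width give squares, and products, up to O(4^-q) ([mul_approx_err],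
[net_mul_approx]).  Matrix products are sums of such products
([net_quadratic]), with accuracy q of the order of log(1/e) plus the logarithm
of the dimensions.

Inversion.  The Gram matrix S = B^T B has its spectrum in [beta^2, alpha^2],
so that X_0 = alpha^-2 I has the residual |I - S X_0| <= 1 - beta^2 / alpha^2.
The Newton iteration X <- 2 X - X (S X) squares the residual and corrects its
own rounding errors ([newton_residual], [newton_iter]); after about
log2(log2(1/e)) steps the residual is of order e.  Concatenation doubles the
number of weights, so m nested steps cost a factor 2^m, which is only of the
order of log2(1/e).

Errors.  [solve_error] collects the three sources of error: the networks given
for B and f, which together contribute at most 3 e / 8, the rounding in the
products, and the residual of the last Newton step.

Sizes.  [solver_network] assembles the network.  It multiplies B^T f first,
because only the d entries of the result must then be carried along while the
inverse is computed.  Each network for B or f goes through at most four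
concatenations on the way of the right-hand side, and three on the way of the
inverse, which accounts for the factors 16 and 8.  All remaining costs are
absorbed by the two constants, since log2(log2(1/e)) >= 1. *)

Set Implicit Arguments.
Unset Strict Implicit.
Unset Printing Implicit Defensive.

Import Order.TTheory GRing.Theory Num.Theory.
Local Open Scope classical_set_scope.
Local Open Scope ring_scope.

(** * Networks between spaces of functions on finite types *)

Section Nets.
Variable R : realType.
Implicit Types (I J K : finType) (h M : nat).

Definition affine_map I J (W : J -> I -> R) (b : J -> R) (u : I -> R) : J -> R :=
  fun j => \sum_i W j i * u i + b j.

Definition nz_vec J (b : J -> R) : nat := (\sum_j (b j != 0%R))%N.
Definition nz_mat I J (W : J -> I -> R) : nat := (\sum_j nz_vec (W j))%N.

(** The parameter h counts the hidden layers, so there are h+1 layers, and M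
bounds the number of nonzero parameters.  With arbitrary finite types as sets
of units, direct sums of layers are sums of types and need no casts between
dimensions; with the depth as an explicit index, two networks of the same depth
can be treated by one induction. *)
Fixpoint net h I J (f : (I -> R) -> J -> R) M : Prop :=
  if h is h'.+1 then
    exists (K : finType) (W : K -> I -> R) (b : K -> R) (g : (K -> R) -> J -> R) M',
    [/\ (0 < #|K|)%N, net h' g M', (nz_mat W + nz_vec b + M' <= M)%N &
        forall u, f u = g (fun k => Num.max 0 (affine_map W b u k))]
  else exists (W : J -> I -> R) (b : J -> R),
    (nz_mat W + nz_vec b <= M)%N /\ forall u, f u = affine_map W b u.

Lemma net_weaken h I J (f : (I -> R) -> J -> R) M M' :
  (M <= M')%N -> net h f M -> net h f M'.
Proof.
case: h => [|h] MM' /=.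
  by move=> [W [b [hM hf]]]; exists W, b; split => //; exact: leq_trans MM'.
move=> [K [W [b [g [Mg [K0 hg hM hf]]]]]]; exists K, W, b, g, Mg; split => //.
exact: leq_trans MM'.
Qed.

Lemma net_ext h I J (f g : (I -> R) -> J -> R) M :
  (forall u j, f u j = g u j) -> net h f M -> net h g M.
Proof. by move=> fg; suff -> : f = g by []; apply/funext => u; apply/funext => j. Qed.

Definition fmul I J K (A : J -> K -> R) (B : K -> I -> R) : J -> I -> R :=
  fun j i => \sum_k A j k * B k i.

Lemma sum_neq0_le K (F : K -> R) :
  (((\sum_k F k)%R != 0%R) <= \sum_k (F k != 0%R))%N.
Proof.
have [//|h] := eqVneq (\sum_k F k) 0; rewrite lt0n.
apply: contra_neqN h; rewrite sum_nat_eq0 => /forallP h.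
by rewrite big1 // => k _; have := h k; rewrite /= eqb0 negbK => /eqP.
Qed.

Lemma fmul_neq0_le I J K (A : J -> K -> R) (B : K -> I -> R) j i :
  ((fmul A B j i != 0%R) <= \sum_k (A j k != 0%R) * (B k i != 0%R))%N.
Proof.
apply: leq_trans (sum_neq0_le _) _; apply: leq_sum => k _.
by rewrite mulf_eq0 negb_or mulnb.
Qed.

(** Each entry of A meets a single row of B. *)
Lemma nz_mat_fmul_sparse_rows I J K (A : J -> K -> R) (B : K -> I -> R) r :
  (forall k, nz_vec (B k) <= r)%N -> (nz_mat (fmul A B) <= r * nz_mat A)%N.
Proof.
move=> hB; rewrite /nz_mat big_distrr /=; apply: leq_sum => j _.
apply: (@leq_trans (\sum_i \sum_k (A j k != 0%R) * (B k i != 0%R))%N).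
  by apply: leq_sum => i _; exact: fmul_neq0_le.
rewrite exchange_big /= big_distrr /=; apply: leq_sum => k _.
by rewrite -big_distrr /= mulnC leq_mul2r hB orbT.
Qed.

Lemma nz_mat_fmul_sparse_cols I J K (A : J -> K -> R) (B : K -> I -> R) r :
  (forall k, \sum_j (A j k != 0%R) <= r)%N -> (nz_mat (fmul A B) <= r * nz_mat B)%N.
Proof.
move=> hA; rewrite /nz_mat.
apply: (@leq_trans (\sum_j \sum_i \sum_k (A j k != 0%R) * (B k i != 0%R))%N).
  by apply: leq_sum => j _; apply: leq_sum => i _; exact: fmul_neq0_le.
under eq_bigr do rewrite exchange_big /=.
rewrite exchange_big /= big_distrr /=; apply: leq_sum => k _.
rewrite exchange_big /= /nz_vec big_distrr /=; apply: leq_sum => i _.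
by rewrite -big_distrl /= leq_mul2r hA orbT.
Qed.

Definition lin I J (P : J -> I -> R) (u : I -> R) : J -> R :=
  fun j => \sum_i P j i * u i.

Lemma lin_lin I J K (A : J -> K -> R) (B : K -> I -> R) u j :
  lin A (lin B u) j = lin (fmul A B) u j.
Proof.
rewrite /lin /fmul; under eq_bigr do rewrite mulr_sumr.
rewrite exchange_big /=; apply: eq_bigr => i _.
by rewrite mulr_suml; apply: eq_bigr => k _; rewrite mulrA.
Qed.

(** Only the first layer changes: its weights are multiplied by P, while its
bias stays the same because P has no constant term. *)
Lemma net_precomp h I I' J (f : (I -> R) -> J -> R) M (P : I -> I' -> R) r :
  (0 < r)%N -> (forall i, nz_vec (P i) <= r)%N ->
  net h f M -> net h (fun u => f (lin P u)) (r * M).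
Proof.
move=> r0 hP.
have affE (L : finType) (W : L -> I -> R) (b : L -> R) u :
    affine_map W b (lin P u) = affine_map (fmul W P) b u.
  by apply/funext => k; rewrite /affine_map; congr (_ + _); exact: lin_lin.
case: h => [|h] /=.
  move=> [W [b [hM hf]]]; exists (fmul W P), b; split.
    have := nz_mat_fmul_sparse_rows W hP; nia.
  by move=> u; rewrite hf affE.
move=> [K [W [b [g [Mg [K0 hg hM hf]]]]]].
exists K, (fmul W P), b, g, Mg; split => //.
  have := nz_mat_fmul_sparse_rows W hP; nia.
by move=> u; rewrite hf affE.
Qed.

Lemma net_postcomp h I J J' (f : (I -> R) -> J -> R) M (Q : J' -> J -> R) r :
  (0 < r)%N -> (forall j, \sum_j' (Q j' j != 0%R) <= r)%N ->
  net h f M -> net h (fun u => lin Q (f u)) (r * M).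
Proof.
move=> r0 hQ; elim: h I f M => [|h IH] I f M /=.
  move=> [W [b [hM hf]]]; exists (fmul Q W), (lin Q b); split.
    have h1 := nz_mat_fmul_sparse_cols W hQ.
    have h2 : (nz_vec (lin Q b) <= r * nz_vec b)%N.
      have := @nz_mat_fmul_sparse_cols unit _ _ Q (fun k _ => b k) r hQ.
      have nzu (L : finType) (v : L -> R) : nz_mat (fun k (_ : unit) => v k) = nz_vec v.
        apply: eq_bigr => k _; rewrite /nz_vec (bigD1 tt) //= big1 ?addn0 //.
      by rewrite -[nz_mat (fmul _ _)]/(nz_mat (fun k (_ : unit) => lin Q b k)) !nzu.
    nia.
  move=> u; apply/funext => j; rewrite hf /affine_map -/(lin _ _ _) -lin_lin.
  rewrite /lin -big_split /=; apply: eq_bigr => k _.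
  by rewrite -mulrDr.
move=> [K [W [b [g [Mg [K0 hg hM hf]]]]]].
exists K, W, b, (fun u => lin Q (g u)), (r * Mg)%N; split => //.
- exact: IH.
- nia.
- by move=> u; rewrite hf.
Qed.

Definition delta I (c : R) (i0 i : I) : R := (i == i0)%:R * c.

Lemma nz_vec_delta I (i0 : I) (c : R) : (nz_vec (delta c i0) <= 1)%N.
Proof.
rewrite /nz_vec /delta (bigD1 i0) //= big1 ?addn0 ?leq_b1 // => i /negbTE ->.
by rewrite mul0r eqxx.
Qed.

Lemma sum_delta I (c : R) (i0 : I) (F : I -> R) : \sum_i delta c i0 i * F i = c * F i0.
Proof.
rewrite (bigD1 i0) //= /delta eqxx mul1r big1 ?addr0 // => i /negbTE ->.
by rewrite !mul0r.
Qed.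

Lemma lin_delta I I' (s : I -> I') (u : I' -> R) i :
  lin (fun i => delta 1 (s i)) u i = u (s i).
Proof. by rewrite /lin sum_delta mul1r. Qed.

Lemma net_reindex_input h I I' J (f : (I -> R) -> J -> R) M (s : I -> I') :
  net h f M -> net h (fun u => f (fun i => u (s i))) M.
Proof.
move=> /(@net_precomp _ _ I' _ _ _ (fun i => delta 1 (s i)) 1 isT).
rewrite mul1n => hn; apply: net_ext (hn _) => [u j|i]; last exact: nz_vec_delta.
by congr f; apply/funext => i; rewrite lin_delta.
Qed.

(** Writing outputs into selected coordinates of a larger vector is free; sums
of such embeddings ([net_add]) are the way to put networks in parallel. *)
Lemma net_embed h I J J' (f : (I -> R) -> J -> R) M (s : J -> J') (c : J -> R) :
  net h f M -> net h (fun u j' => \sum_j delta (c j) (s j) j' * f u j) M.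
Proof.
move=> /(@net_postcomp _ _ _ J' _ _ (fun j' j => delta (c j) (s j) j') 1 isT).
by rewrite mul1n; apply => j; exact: nz_vec_delta.
Qed.

Lemma net_reindex_output h I J J' (f : (I -> R) -> J -> R) M (s : J' -> J) :
  injective s -> net h f M -> net h (fun u j' => f u (s j')) M.
Proof.
move=> sI /(@net_postcomp _ _ _ J' _ _ (fun j' => delta 1 (s j')) 1 isT).
rewrite mul1n => hn; apply: net_ext (hn _) => [u j|j]; first exact: lin_delta.
rewrite /delta; have [[j0 ->]|h0] := pselect (exists j0, j = s j0); last first.
  rewrite big1 // => j' _; case: (j =P s j') => [e|_]; last by rewrite mul0r eqxx.
  by case: h0; exists j'.
rewrite (bigD1 j0) //= big1 ?addn0 ?leq_b1 // => j'.
by rewrite (inj_eq sI) eq_sym => /negbTE ->; rewrite mul0r eqxx.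
Qed.

Lemma nz_vec0 J : nz_vec (fun _ : J => 0 : R) = 0%N.
Proof. by rewrite /nz_vec big1 // => i _; rewrite eqxx. Qed.

Lemma nz_vecD J (v w : J -> R) : (nz_vec (fun j => v j + w j)%R <= nz_vec v + nz_vec w)%N.
Proof.
rewrite /nz_vec -big_split; apply: leq_sum => j _ /=.
have [->|_] := eqVneq (v j) 0; first by rewrite add0r.
by rewrite (leq_trans (leq_b1 _)).
Qed.

Lemma net_bias h I J (f : (I -> R) -> J -> R) M (c : J -> R) :
  net h f M -> net h (fun u j => f u j + c j) (M + nz_vec c).
Proof.
elim: h I f M => [|h IH] I f M /=.
  move=> [W [b [hM hf]]]; exists W, (fun j => b j + c j); split.
    by have := nz_vecD b c; lia.
  by move=> u; apply/funext => j; rewrite hf /affine_map addrA.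
move=> [K [W [b [g [Mg [K0 hg hM hf]]]]]].
exists K, W, b, (fun u j => g u j + c j), (Mg + nz_vec c)%N; split => //.
- exact: IH.
- lia.
- by move=> u; rewrite hf.
Qed.

Lemma nz_mat_card I J (W : J -> I -> R) : (nz_mat W <= #|J| * #|I|)%N.
Proof.
rewrite /nz_mat /nz_vec -sum_nat_const; apply: leq_sum => j _.
by rewrite -sum1_card; apply: leq_sum => i _; exact: leq_b1.
Qed.

Lemma nz_vec_card J (b : J -> R) : (nz_vec b <= #|J|)%N.
Proof. by rewrite /nz_vec -sum1_card; apply: leq_sum => i _; exact: leq_b1. Qed.

Definition sum_case I1 I2 (T : Type) (u : I1 -> T) (v : I2 -> T) : I1 + I2 -> T :=
  fun i => match i with inl a => u a | inr b => v b end.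

Lemma nz_mat_sum_case I J1 J2 (W1 : J1 -> I -> R) (W2 : J2 -> I -> R) :
  nz_mat (sum_case W1 W2) = (nz_mat W1 + nz_mat W2)%N.
Proof. by rewrite /nz_mat big_sumType. Qed.

Lemma nz_vec_sum_case I J (W1 : I -> R) (W2 : J -> R) : nz_vec (sum_case W1 W2) = (nz_vec W1 + nz_vec W2)%N.
Proof. by rewrite /nz_vec big_sumType. Qed.

Lemma card_sum_gt0 I J : (0 < #|I|)%N -> (0 < #|{: I + J}|)%N.
Proof. by move=> h; rewrite card_sum addn_gt0 h. Qed.

(** The two networks run side by side on the same input; their hidden units form
a disjoint union and only the output layer adds the results. *)
Lemma net_add h I J (f g : (I -> R) -> J -> R) M1 M2 :
  net h f M1 -> net h g M2 -> net h (fun u j => f u j + g u j) (M1 + M2).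
Proof.
elim: h I f g M1 M2 => [|h IH] I f g M1 M2 /=.
  move=> [W1 [b1 [h1 f1]]] [W2 [b2 [h2 f2]]].
  exists (fun j i => W1 j i + W2 j i), (fun j => b1 j + b2 j); split.
    have : (nz_mat (fun j i => W1 j i + W2 j i)%R <= nz_mat W1 + nz_mat W2)%N.
      by rewrite /nz_mat -big_split; apply: leq_sum => j _ /=; exact: nz_vecD.
    have := nz_vecD b1 b2; lia.
  move=> u; apply/funext => j; rewrite f1 f2 /affine_map addrACA -big_split /=.
  by congr (_ + _); apply: eq_bigr => i _; rewrite mulrDl.
move=> [K1 [W1 [b1 [g1 [N1 [k1 n1 m1 e1]]]]]] [K2 [W2 [b2 [g2 [N2 [k2 n2 m2 e2]]]]]].
exists (K1 + K2)%type, (sum_case W1 W2), (sum_case b1 b2).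
exists (fun v j => g1 (fun k => v (inl k)) j + g2 (fun k => v (inr k)) j), (N1 + N2)%N.
split.
- exact: card_sum_gt0.
- by apply: IH; apply: net_reindex_input.
- by rewrite nz_mat_sum_case nz_vec_sum_case; lia.
- by move=> u; apply/funext => j; rewrite e1 e2.
Qed.

Lemma net_zero h I J : net h (fun (_ : I -> R) (_ : J) => 0) 0.
Proof.
have z (I' J' : finType) : nz_mat (fun (_ : J') (_ : I') => 0 : R) = 0%N.
  by rewrite /nz_mat big1 // => j _; exact: nz_vec0.
elim: h I => [|h IH] I /=.
  exists (fun _ _ => 0), (fun _ => 0); split; first by rewrite z nz_vec0.
  move=> u; apply/funext => j; rewrite /affine_map big1 ?addr0 // => i _.
  by rewrite mul0r.
exists unit, (fun _ _ => 0), (fun _ => 0), (fun _ _ => 0), 0%N; split => //.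
- by rewrite card_unit.
- by rewrite z nz_vec0.
Qed.

Lemma net_bigsum h I J (T : Type) (r : seq T) (f : T -> (I -> R) -> J -> R) (M : T -> nat) :
  (forall t, net h (f t) (M t)) ->
  net h (fun u j => \sum_(t <- r) f t u j) (\sum_(t <- r) M t).
Proof.
move=> hn; elim: r => [|t r IH].
  rewrite big_nil; apply: net_ext (net_zero h I J) => u j.
  by rewrite big_nil.
rewrite big_cons; apply: net_ext (net_add (hn t) IH) => u j.
by rewrite big_cons.
Qed.

Lemma net_par h I J1 J2 (f : (I -> R) -> J1 -> R) (g : (I -> R) -> J2 -> R) M1 M2 :
  net h f M1 -> net h g M2 -> net h (fun u => sum_case (f u) (g u)) (M1 + M2).
Proof.
move=> hf hg.
apply: net_ext (net_add (net_embed (fun j => inl j : J1 + J2) (fun=> 1) hf)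
                        (net_embed (fun j => inr j : J1 + J2) (fun=> 1) hg)).
have sym (L L' : finType) (s : L -> L') (sI : injective s) k (F : L -> R) :
    \sum_j delta 1 (s j) (s k) * F j = F k.
  rewrite -[RHS]mul1r -(sum_delta 1 k); apply: eq_bigr => j _.
  by rewrite /delta (inj_eq sI) eq_sym.
move=> u [j|j] /=.
  rewrite sym => [|? ? []//].
  by rewrite [X in _ + X]big1 ?addr0 // => k _; rewrite /delta !mul0r.
rewrite [X in _ + X]sym => [|? ? []//].
by rewrite [X in X + _]big1 ?add0r // => k _; rewrite /delta !mul0r.
Qed.

Lemma relu_split (x : R) : Num.max 0 x - Num.max 0 (- x) = x.
Proof.
have [h|h] := leP 0 x.
  by rewrite max_l ?subr0 // oppr_le0.
by rewrite max_r ?sub0r ?opprK // oppr_ge0 ltW.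
Qed.

(** Recovers a vector from its positive and negative parts. *)
Definition split_pm I : I -> I + I -> R := fun i => sum_case (delta 1 i) (delta (-1) i).

Lemma nz_vec_split_pm I (i : I) : (nz_vec (split_pm i) <= 2)%N.
Proof. by rewrite nz_vec_sum_case; have := nz_vec_delta i 1; have := nz_vec_delta i (-1); lia. Qed.

Lemma lin_split_pm I (v : I + I -> R) i : lin (@split_pm I) v i = v (inl i) - v (inr i).
Proof. by rewrite /lin big_sumType /= !sum_delta mul1r mulN1r. Qed.

(** The output x of the first network is not activated, so it is passed on as
the pair of its positive and negative parts.  This doubles the last layer of the
first network and the first layer of the second one.  The factor 2 of each
concatenation is what the factors 16 and 8 of the theorem are made of. *)
Lemma net_comp h1 h2 I J K (f : (I -> R) -> J -> R) (g : (J -> R) -> K -> R) M1 M2 :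
  (0 < #|J|)%N -> net h1 f M1 -> net h2 g M2 ->
  net (h1 + h2).+1 (fun u => g (f u)) (2 * M1 + 2 * M2).
Proof.
move=> J0; elim: h1 I f M1 => [|h1 IH] I f M1 hf hg; last first.
  case: hf => [L [W [b [f' [M' [K0 hf' hM fE]]]]]] /=.
  exists L, W, b, (fun u => g (f' u)), (2 * M' + 2 * M2)%N; split => //.
  - exact: IH.
  - lia.
  - by move=> u; rewrite fE.
case: hf => [W [b [hM fE]]].
exists (J + J)%type, (sum_case W (fun j i => - W j i)), (sum_case b (fun j => - b j)).
exists (fun v => g (lin (@split_pm J) v)), (2 * M2)%N; split.
- exact: card_sum_gt0.
- by apply: net_precomp => //; exact: nz_vec_split_pm.
- rewrite nz_mat_sum_case nz_vec_sum_case.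
  have nvN (L : finType) (v : L -> R) : nz_vec (fun j => - v j) = nz_vec v.
    by rewrite /nz_vec; apply: eq_bigr => j _; rewrite oppr_eq0.
  rewrite nvN; have -> : nz_mat (fun j i => - W j i) = nz_mat W.
    by rewrite /nz_mat; apply: eq_bigr => j _; exact: nvN.
  lia.
- move=> u; congr g; apply/funext => j; rewrite lin_split_pm /= fE.
  rewrite -[LHS]relu_split /affine_map /=; congr (_ - Num.max _ _).
  rewrite opprD -sumrN; congr (_ + _).
  by apply: eq_bigr => i _; rewrite mulNr.
Qed.

Lemma nz_mat_delta I J (s : J -> I) c : (nz_mat (fun j => delta c (s j)) <= #|J|)%N.
Proof. by rewrite -sum1_card; apply: leq_sum => j _; exact: nz_vec_delta. Qed.

Lemma net_id0 I : net 0 (fun u : I -> R => u) #|I|.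
Proof.
exists (fun j => delta 1 j), (fun _ => 0); split; last first.
  by move=> u; apply/funext => j; rewrite /affine_map addr0 sum_delta mul1r.
by rewrite nz_vec0 addn0; exact: nz_mat_delta.
Qed.

Lemma net_id h I : (0 < #|I|)%N -> net h (fun u : I -> R => u) (2 * h.+1 * #|I|).
Proof.
(* The identity is carried through a hidden layer as its positive and
   negative parts, which further hidden layers leave unchanged. *)
move=> I0.
pose carry k (v : I + I -> R) := lin (@split_pm I) (fun j => iter k (Num.max 0) (v j)).
have ncarry k : net k (carry k) (2 * k.+1 * #|I|).
  elim: k => [|k IHk].
    by apply: net_weaken (net_precomp (isT : (0 < 2)%N) (@nz_vec_split_pm I) (net_id0 I)); lia.
  exists (I + I)%type, (fun j => delta 1 j), (fun _ => 0), (carry k), (2 * k.+1 * #|I|)%N.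
  split => //; first exact: card_sum_gt0.
    rewrite nz_vec0; apply: leq_trans (leq_add (leq_add (nz_mat_delta _ _) (leqnn 0)) (leqnn _)) _.
    rewrite card_sum; lia.
  move=> u; rewrite /carry; congr lin; apply/funext => j; rewrite iterSr; congr iter.
  by rewrite /affine_map addr0 sum_delta mul1r.
case: h => [|h]; first by apply: net_weaken (net_id0 I); lia.
exists (I + I)%type, (sum_case (fun j => delta 1 j) (fun j => delta (-1) j)), (fun _ => 0).
exists (carry h), (2 * h.+1 * #|I|)%N.
split => //; first exact: card_sum_gt0.
  rewrite nz_vec0 nz_mat_sum_case.
  apply: leq_trans (leq_add (leq_add (leq_add (nz_mat_delta _ _) (nz_mat_delta _ _)) (leqnn 0)) (leqnn _)) _.
  lia.
move=> u; apply/funext => j.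
have itm k (x : R) : iter k (Num.max 0) (Num.max 0 x) = Num.max 0 x.
  by elim: k => //= k ->; rewrite maxA maxxx.
by rewrite /carry lin_split_pm !itm /affine_map /= !sum_delta !addr0 mul1r mulN1r relu_split.
Qed.

(** Padding is concatenation with a network for the identity: it doubles the
weights once, whatever the number of added layers. *)
Lemma net_pad h I J (f : (I -> R) -> J -> R) M k :
  (0 < #|J|)%N -> net h f M ->
  net (h + k).+1 f (2 * M + 4 * k.+1 * #|J|).
Proof.
move=> J0 hf; apply: net_weaken (net_comp J0 hf (net_id k J0)); lia.
Qed.

End Nets.

(** * Matrix networks, squares and products *)

Section Conv.
Variable R : realType.
Implicit Types (I J K : finType) (h M : nat).

Lemma net_of_network n m (Phi : network R n m) :
  net (layers Phi).-1 (fun u j => realization Phi (\col_i u i) j 0) (weights Phi).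
Proof.
have nnzb k (b : 'cV[R]_k) : nnz b = nz_vec (fun j => b j 0).
  by apply: eq_bigr => j _; rewrite big_ord1.
have affE n' m' (W : 'M[R]_(m', n')) (b : 'cV[R]_m') u j :
    (W *m (\col_i u i) + b) j 0 = affine_map (fun j i => W j i) (fun j => b j 0) u j.
  by rewrite !mxE /affine_map; congr (_ + _); apply: eq_bigr => i _; rewrite mxE.
elim: Phi => [{}n {}m W b|{}n k {}m W b hk Phi IH] /=.
  exists (fun j i => W j i), (fun j => b j 0); rewrite nnzb; split => // u.
  by apply/funext => j; exact: affE.
have -> : layers Phi = (layers Phi).-1.+1 by case: {IH} Phi.
exists 'I_k, (fun j i => W j i), (fun j => b j 0).
exists (fun u j => realization Phi (\col_i u i) j 0), (weights Phi).
split => //; rewrite ?card_ord ?nnzb //.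
move=> u; apply/funext => j; congr (realization Phi _ j 0).
by apply/matrixP => i l; rewrite ord1 !mxE -affE !mxE.
Qed.

(** The enumerations of the inputs and outputs are arbitrary bijections because
in the induction the hidden units get the enumeration of their finite type, while
the ordinals of the final network must be kept in their own order. *)
Lemma network_of_net_bij h n m I J (a : 'I_n -> I) (a' : I -> 'I_n) (b : 'I_m -> J) b'
    (f : (I -> R) -> J -> R) M :
  cancel a a' -> cancel a' a -> cancel b b' -> cancel b' b -> net h f M ->
  exists Phi : network R n m, [/\ layers Phi = h.+1, (weights Phi <= M)%N &
    forall x j, realization Phi x j 0 = f (fun i => x (a' i) 0) (b j)].
Proof.
move=> aK a'K bK b'K.
have nz_vecE (k : nat) (L : finType) (c : 'I_k -> L) c' : cancel c c' -> cancel c' c ->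
    forall v : L -> R, (\sum_(i < k) (v (c i) != 0%R))%N = nz_vec v.
  by move=> cK c'K v; rewrite /nz_vec [RHS](reindex c) //=; exists c' => i _.
elim: h n I a a' aK a'K f M => [|h IH] n I a a' aK a'K f M.
  move=> [W [v [hM hf]]].
  exists (OutputLayer (\matrix_(j, i) W (b j) (a i)) (\col_j v (b j))).
  split => //=.
    apply: leq_trans hM; rewrite leq_add //.
      rewrite /nz_mat (reindex b) /=; last by exists b' => i _.
      apply: leq_sum => j _; rewrite -(nz_vecE _ _ _ _ aK a'K).
      by apply: leq_sum => i _; rewrite mxE.
    rewrite -(nz_vecE _ _ _ _ bK b'K).
    by apply: leq_sum => i _; rewrite big_ord1 mxE.
  move=> x j; rewrite hf !mxE /affine_map; congr (_ + _).
  rewrite [RHS](reindex a) /=; last by exists a' => i _.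
  by apply: eq_bigr => i _; rewrite mxE aK.
move=> [K [W [v [g [M' [K0 hg hM hf]]]]]].
pose c : 'I_#|K| -> K := enum_val.
have cK : cancel c enum_rank := @enum_valK K.
have c'K : cancel enum_rank c := @enum_rankK K.
have [Phi [hL hW hr]] := IH _ _ _ _ cK c'K g M' hg.
exists (HiddenLayer (\matrix_(j, i) W (c j) (a i)) (\col_j v (c j)) K0 Phi).
split => /=.
- by rewrite hL.
- apply: leq_trans hM; rewrite !leq_add //.
    rewrite /nz_mat (reindex c) /=; last by exists enum_rank => i _.
    apply: leq_sum => j _; rewrite -(nz_vecE _ _ _ _ aK a'K).
    by apply: leq_sum => i _; rewrite mxE.
  rewrite -(nz_vecE _ _ _ _ cK c'K).
  by apply: leq_sum => i _; rewrite big_ord1 mxE.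
- move=> x j; rewrite hr hf; congr (g _ _); apply/funext => k.
  rewrite !mxE c'K; congr (Num.max _ (_ + _)).
  rewrite [RHS](reindex a) /=; last by exists a' => i _.
  by apply: eq_bigr => i _; rewrite mxE aK c'K.
Qed.

Lemma network_of_net h n m (f : ('I_n -> R) -> 'I_m -> R) M :
  net h f M ->
  exists Phi : network R n m, [/\ layers Phi = h.+1, (weights Phi <= M)%N &
    forall x j, realization Phi x j 0 = f (fun i => x i 0) j].
Proof. exact: network_of_net_bij. Qed.

(** The identity x^2 = |x| - 1/4 + (2|x| - 1)^2 / 4 iterated m times, ending
with |y| in the place of y^2; if |x| <= 1 then |2|x| - 1| <= 1. *)
Fixpoint sq_approx (m : nat) (x : R) : R :=
  if m is m'.+1 then `|x| - 1 / 4 + sq_approx m' (2 * `|x| - 1) / 4 else `|x|.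

Lemma sq_approx_err m x : `|x| <= 1 -> `|sq_approx m x - x ^+ 2| <= 4^-1 ^+ m.
Proof.
elim: m x => [|m IH] x x1 /=.
  rewrite expr0 -(real_normK (num_real x)); have := normr_ge0 x.
  move: x1; set y := `|x| => y1 y0; rewrite ler_norml; nra.
have y1 : `|2 * `|x| - 1| <= 1.
  by rewrite ler_norml; have := normr_ge0 x; lra.
have := IH _ y1; rewrite -(real_normK (num_real x)).
set y := `|x|; set q := sq_approx _ _ => h.
have -> : y - 1 / 4 + q / 4 - y ^+ 2 = 4^-1 * (q - (2 * y - 1) ^+ 2) by field.
by rewrite normrM gtr0_norm // [leRHS]exprS ler_pM2l.
Qed.

(** Lets layers be given by formulas for their units instead of by matrices. *)
Definition affine1 I (phi : (I -> R) -> R) : Prop :=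
  exists w b, forall u, phi u = \sum_i w i * u i + b.

Lemma affine1_coord I (i : I) : affine1 (fun u => u i).
Proof. by exists (delta 1 i), 0 => u; rewrite sum_delta mul1r addr0. Qed.

Lemma affine1_cst I c : affine1 (fun u : I -> R => c).
Proof. by exists (fun=> 0), c => u; rewrite big1 ?add0r // => i _; rewrite mul0r. Qed.

Lemma affine1D I (phi psi : (I -> R) -> R) :
  affine1 phi -> affine1 psi -> affine1 (fun u => phi u + psi u).
Proof.
move=> [w [b hw]] [v [c hv]]; exists (fun i => w i + v i), (b + c) => u.
rewrite hw hv addrACA -big_split; congr (_ + _).
by apply: eq_bigr => i _; rewrite mulrDl.
Qed.

Lemma affine1Z I (phi : (I -> R) -> R) c :
  affine1 phi -> affine1 (fun u => c * phi u).
Proof.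
move=> [w [b hw]]; exists (fun i => c * w i), (c * b) => u.
rewrite hw mulrDr mulr_sumr; congr (_ + _).
by apply: eq_bigr => i _; rewrite mulrA.
Qed.

Lemma affine_aff I J (F : (I -> R) -> J -> R) :
  (forall j, affine1 (fun u => F u j)) ->
  exists W b, forall u, F u = affine_map W b u.
Proof.
move=> hF; pose wb j := cid (hF j).
exists (fun j => projT1 (wb j)); pose b j := cid (projT2 (wb j)).
exists (fun j => projT1 (b j)) => u; apply/funext => j.
exact: (projT2 (b j)).
Qed.

Lemma net_affine I J (F : (I -> R) -> J -> R) :
  (forall j, affine1 (fun u => F u j)) -> net 0 F (#|J| * #|I| + #|J|).
Proof.
move=> /affine_aff [W [b hF]]; exists W, b; split => //.
by rewrite leq_add ?nz_mat_card ?nz_vec_card.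
Qed.

(** The weights are counted as if the layer were full, which is enough for
layers of constant size. *)
Lemma net_layer h I K J (F : (I -> R) -> K -> R) (g : (K -> R) -> J -> R) M :
  (0 < #|K|)%N -> (forall k, affine1 (fun u => F u k)) -> net h g M ->
  net h.+1 (fun u => g (fun k => Num.max 0 (F u k))) (#|K| * #|I| + #|K| + M).
Proof.
move=> K0 /affine_aff [W [b hF]] hg; exists K, W, b, g, M; split => //.
  by rewrite !leq_add ?nz_mat_card ?nz_vec_card.
by move=> u; congr g; apply/funext => k; rewrite hF.
Qed.

(** The arguments of the four units of a layer of the squaring network: an
accumulator a (first component false) and the current argument x (true), each
with both signs. *)
Definition signed_pair (a x : R) : bool * bool -> R :=
  fun i => (if i.2 then -1 else 1) * (if i.1 then x else a).

Definition acc_val (r : bool * bool -> R) : R := r (false, false) - r (false, true).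
Definition arg_abs (r : bool * bool -> R) : R := r (true, false) + r (true, true).

(** What remains of the squaring network after an activation.  The four units r
hold the positive and negative parts of the accumulator and of the argument, and c
is the weight with which the square of the argument enters the result.  Only
fully formed layers occur here, so that no concatenation and no doubling of
weights takes place within the squaring network. *)
Fixpoint sq_tail (m : nat) (c : R) (r : bool * bool -> R) : R :=
  if m is m'.+1 then
    sq_tail m' (c / 4)
      (fun i => Num.max 0 (signed_pair (acc_val r + c * arg_abs r - c / 4) (2 * arg_abs r - 1) i))
  else acc_val r + c * arg_abs r.

Lemma relu_abs (x : R) : Num.max 0 x + Num.max 0 (- x) = `|x|.
Proof.
have [h|h] := leP 0 x; first by rewrite max_l ?addr0 ?oppr_le0 // ger0_norm.
by rewrite max_r ?add0r ?oppr_ge0 1?ltW // ltr0_norm.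
Qed.

Lemma sq_tailE m c a x :
  sq_tail m c (fun i => Num.max 0 (signed_pair a x i)) = a + c * sq_approx m x.
Proof.
have accE b y : acc_val (fun i => Num.max 0 (signed_pair b y i)) = b.
  by rewrite /acc_val /signed_pair /= mul1r mulN1r relu_split.
have absE b y : arg_abs (fun i => Num.max 0 (signed_pair b y i)) = `|y|.
  by rewrite /arg_abs /signed_pair /= mul1r mulN1r relu_abs.
elim: m c a x => [|m IH] c a x /=; first by rewrite accE absE.
by rewrite IH accE absE; field.
Qed.

Lemma affine1_acc_val : affine1 acc_val.
Proof.
rewrite /acc_val; apply: affine1D; first exact: affine1_coord.
have := affine1Z (-1) (affine1_coord (false, true)).
by under eq_fun do rewrite mulN1r.
Qed.

Lemma affine1_arg_abs : affine1 arg_abs.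
Proof. by apply: affine1D; exact: affine1_coord. Qed.

Lemma affine1_signed_pair I (phi psi : (I -> R) -> R) i :
  affine1 phi -> affine1 psi -> affine1 (fun u => signed_pair (phi u) (psi u) i).
Proof. by move=> h1 h2; rewrite /signed_pair; apply: affine1Z; case: (i.1). Qed.

Lemma net_sq_tail m c : net m (fun r (_ : unit) => sq_tail m c r) (20 * m.+1).
Proof.
elim: m c => [|m IH] c.
  have hF : forall j : unit, affine1 (fun r => acc_val r + c * arg_abs r).
    by move=> _; apply: affine1D affine1_acc_val _; apply: affine1Z affine1_arg_abs.
  apply: net_weaken (net_affine hF).
  by rewrite card_unit card_prod card_bool.
have hF i : affine1 (fun r => signed_pair (acc_val r + c * arg_abs r - c / 4) (2 * arg_abs r - 1) i).
  apply: affine1_signed_pair; apply: affine1D; try exact: affine1_cst.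
    by apply: affine1D affine1_acc_val _; apply: affine1Z affine1_arg_abs.
  exact: affine1Z affine1_arg_abs.
apply: net_weaken (net_layer _ hF (IH (c / 4))); rewrite card_prod card_bool //.
lia.
Qed.

(** Polarization, xy = c^2 (((x + y) / 2c)^2 - ((x - y) / 2c)^2): the scaling by
2c brings the arguments of the squares into [-1, 1] when |x|, |y| <= c. *)
Definition mul_approx (m : nat) (c : R) (x y : R) : R :=
  c ^+ 2 * sq_approx m ((x + y) / (2 * c)) - c ^+ 2 * sq_approx m ((x - y) / (2 * c)).

Lemma mul_approx_err m (c x y : R) : 0 < c -> `|x| <= c -> `|y| <= c ->
  `|mul_approx m c x y - x * y| <= 2 * c ^+ 2 * 4^-1 ^+ m.
Proof.
move=> c0 hx hy.
have small (z : R) : `|z| <= 2 * c -> `|z / (2 * c)| <= 1.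
  move=> hz; have c2 : 0 < 2 * c by rewrite mulr_gt0.
  by rewrite normrM normfV (gtr0_norm c2) ler_pdivrMr ?mul1r.
have h1 : `|(x + y) / (2 * c)| <= 1.
  by apply: small; apply: le_trans (ler_normD _ _) _; lra.
have h2 : `|(x - y) / (2 * c)| <= 1.
  by apply: small; apply: le_trans (ler_normB _ _) _; lra.
have := sq_approx_err m h1; have := sq_approx_err m h2; rewrite /mul_approx.
set p := sq_approx _ _; set q := sq_approx _ _ => e2 e1.
have -> : c ^+ 2 * q - c ^+ 2 * p - x * y =
  c ^+ 2 * (q - ((x + y) / (2 * c)) ^+ 2) - c ^+ 2 * (p - ((x - y) / (2 * c)) ^+ 2).
  by field; rewrite gt_eqF.
apply: le_trans (ler_normB _ _) _; have c2 : 0 <= c ^+ 2 by exact: sqr_ge0.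
rewrite [X in X + _]normrM [X in _ + X]normrM (ger0_norm c2).
have := ler_wpM2l c2 e1; have := ler_wpM2l c2 e2; lra.
Qed.

Lemma net_mul_approx m c I (i j : I) :
  net m.+1 (fun u (_ : unit) => mul_approx m c (u i) (u j)) (96 * m.+1).
Proof.
(* One square: the sum of at most two coordinates is formed by the input layer. *)
have sq k s : net m.+1 (fun (u : bool -> R) (_ : unit) =>
    k * sq_approx m ((u true + s * u false) / (2 * c))) (48 * m.+1).
  have hF l : affine1 (fun u : bool -> R => signed_pair 0 ((u true + s * u false) / (2 * c)) l).
    apply: affine1_signed_pair; first exact: affine1_cst.
    under eq_fun do rewrite mulrC.
    by apply/affine1Z/affine1D; [|apply: affine1Z]; exact: affine1_coord.
  have K0 : (0 < #|{: bool * bool}|)%N by rewrite card_prod card_bool.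
  have := net_layer K0 hF (net_sq_tail m k) => /net_weaken hn.
  apply: net_ext (hn (48 * m.+1)%N _) => [u _|]; last first.
    by rewrite card_prod !card_bool; lia.
  by rewrite sq_tailE add0r.
have := net_reindex_input (fun b : bool => if b then i else j)
          (net_add (sq (c ^+ 2) 1) (sq (- c ^+ 2) (-1))).
move=> /net_weaken hn; apply: net_ext (hn (96 * m.+1)%N _) => [u _|]; last lia.
by rewrite /mul_approx mul1r mulN1r mulNr.
Qed.

(** This form covers every step of the algorithm: the linear term lets a Newton
step subtract from 2 X and keep S, and the constant supplies the initial value of
the iteration. *)
Lemma net_quadratic m c I J (T : finType) (a b : J -> T -> I) (k : J -> R)
    (s : J -> I) (r z : J -> R) : (0 < #|T|)%N ->
  net m.+1 (fun u j => k j * (\sum_t mul_approx m c (u (a j t)) (u (b j t)))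
                        + r j * u (s j) + z j)
    (102 * m.+1 * (#|J| * #|T|)).
Proof.
move=> T0; have U0 : (0 < #|{: unit}|)%N by rewrite card_unit.
have h1 (p : J * T) := net_embed (fun _ => p.1) (fun _ => k p.1)
   (net_mul_approx m c (a p.1 p.2) (b p.1 p.2)).
have h2 (j : J) := net_embed (fun _ => j) (fun _ => r j)
   (net_reindex_input (fun _ : unit => s j) (net_id R m.+1 U0)).
have /net_weaken h := net_bias z (net_add (net_bigsum (index_enum _) h1)
  (net_bigsum (index_enum _) h2)).
apply: net_ext (h _ _) => [u j|].
  rewrite -(pair_bigA _ (fun j' t => \sum_(j0 : unit) delta (k j') j' j * mul_approx m c (u (a j' t)) (u (b j' t)))) /=.
  have unitE (F : unit -> R) : \sum_i F i = F tt.
    by rewrite (bigD1 tt) //= big1 ?addr0 // => -[].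
  congr (_ + _ + _).
    rewrite (bigD1 j) //= [X in _ + X]big1 ?addr0 => [|i /negbTE ij].
      rewrite mulr_sumr; apply: eq_bigr => t _.
      by rewrite unitE /delta eqxx mul1r.
    by rewrite big1 // => t _; rewrite unitE /delta eq_sym ij !mul0r.
  rewrite (bigD1 j) //= [X in _ + X]big1 ?addr0 => [|i /negbTE ij].
    by rewrite unitE /delta eqxx mul1r.
  by rewrite unitE /delta eq_sym ij !mul0r.
rewrite !sum_nat_const card_prod card_unit.
rewrite [#|xpredT|](_ : _ = #|J|) //; have := nz_vec_card z; move: T0.
move: (nz_vec z) #|J| #|T| => nz j t; nia.
Qed.
End Conv.

(** * Euclidean norm, operator norm and spectra *)

Section Euclid.
Variable R : realType.

Lemma norm2_ge0 n (x : 'cV[R]_n) : 0 <= norm2 x.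
Proof. exact: sqrtr_ge0. Qed.

Lemma norm2_sqr n (x : 'cV[R]_n) : norm2 x ^+ 2 = \sum_i x i 0 ^+ 2.
Proof. by rewrite sqr_sqrtr // sumr_ge0 // => i _; exact: sqr_ge0. Qed.

Lemma norm2_le_sqr n m (x : 'cV[R]_n) (y : 'cV[R]_m) c : 0 <= c ->
  \sum_i x i 0 ^+ 2 <= c ^+ 2 * \sum_i y i 0 ^+ 2 -> norm2 x <= c * norm2 y.
Proof.
move=> c0; rewrite -!norm2_sqr -exprMn => h.
by rewrite -(@ler_pXn2r _ 2) // nnegrE ?mulr_ge0 // norm2_ge0.
Qed.

Local Open Scope complex_scope.
Local Open Scope sesquilinear_scope.

(** A real symmetric matrix is unitarily diagonalizable over the complex numbers
and its eigenvalues are real; in an orthonormal eigenbasis the bound is read off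
coordinatewise. *)
Lemma symmetric_opnorm_le n (T : 'M[R]_n) (c : R) : 0 <= c -> T^T = T ->
  (forall a, eigenvalue T a -> `|a| <= c) ->
  forall x : 'cV[R]_n, norm2 (T *m x) <= c * norm2 x.
Proof.
move=> c0 symT hT x.
pose f : {rmorphism R -> R[i]} := real_complex R.
pose Tc : 'M[R[i]]_n := map_mx f T.
have realT : Tc \is a mxOver Num.real.
  by apply/mxOverP => i j; rewrite !mxE complex_real.
have hermT : Tc \is hermsymmx.
  apply: realsym_hermsym => //.
  apply/is_hermitianmxP; rewrite expr0 scale1r map_mx_id //.
  by rewrite /Tc map_trmx symT.
have /hermitian_normalmx /orthomx_spectralP := hermT.
have Dreal := hermitian_spectral_diag_real hermT.
have Punit := spectral_unitarymx Tc.
move: Dreal Punit; set P := spectralmx Tc; set D := spectral_diag Tc.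
move=> Dreal Puni eqT.
have PU := unitarymx_unit Puni.
have Dc i : exists2 r : R, D 0 i = f r & `|r| <= c.
  have /complex_realP [r Er] := (mxOverP Dreal) 0 i.
  exists r => //; apply: hT.
  have : eigenvalue Tc (D 0 i).
    apply/eigenvalueP; exists (row i P); last first.
      apply: contraTneq PU => r0.
      have Pi j : P i j = 0 by move/matrixP/(_ 0 j): r0; rewrite !mxE.
      apply/negP => /mulmxV /matrixP /(_ i i); rewrite !mxE eqxx big1 => [/eqP|j _].
        by rewrite eq_sym oner_eq0.
      by rewrite Pi mul0r.
    rewrite -row_mul eqT !mulmxA mulmxV // mul1mx row_mul row_diag_mx.
    by rewrite -scalemxAl -rowE.
  rewrite Er !eigenvalue_root_char /Tc.
  by rewrite -[char_poly _]map_char_poly fmorph_root.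
apply: norm2_le_sqr => //.
have fconj r : Num.conj (f r) = f r by apply/CrealP; rewrite complex_real.
have nrm m (y : 'cV[R]_m) : f (\sum_i y i 0 ^+ 2) = ((map_mx f y)^t* *m map_mx f y) 0 0.
  rewrite rmorph_sum mxE; apply: eq_bigr => i _; rewrite !mxE rmorphXn /=.
  by rewrite fconj expr2.
pose y := P *m map_mx f x.
rewrite -lecR.
rewrite [X in _ <= X]rmorphM /= -!/(f _) (nrm _ (T *m x)) nrm.
have -> : (map_mx f x)^t* *m map_mx f x = y^t* *m y.
  rewrite /y trmx_mul map_mxM -mulmxA (mulmxA _ P) -(invmx_unitary Puni).
  by rewrite mulVmx // mul1mx.
have -> : (map_mx f (T *m x))^t* *m map_mx f (T *m x)
   = (diag_mx D *m y)^t* *m (diag_mx D *m y).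
  rewrite map_mxM -/Tc eqT /y -!mulmxA (invmx_unitary Puni).
  rewrite [in LHS]trmx_mul map_mxM trmxCK -mulmxA (mulmxA P).
  by move/unitarymxP: Puni => ->; rewrite mul1mx.
rewrite !mxE mulr_sumr; apply: ler_sum => i _.
rewrite mul_diag_mx !mxE.
have [r -> hr] := Dc i.
rewrite rmorphM /=.
rewrite fconj.
rewrite mulrACA ler_wpM2r //; first by rewrite mulrC mul_conjC_ge0.
rewrite -!rmorphM /= lecR.
rewrite -expr2 -real_normK ?num_real // expr2 -expr2.
by rewrite ler_pXn2r // nnegrE.
Qed.
Local Close Scope sesquilinear_scope.
Local Close Scope complex_scope.

Lemma norm2_eq0 n (x : 'cV[R]_n) : norm2 x = 0 -> x = 0.
Proof.
move=> h; have /eqP := norm2_sqr x; rewrite h expr0n /= eq_sym.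
rewrite psumr_eq0 => [/allP hx|i _]; last exact: sqr_ge0.
apply/matrixP => i j; rewrite ord1 mxE; apply/eqP; rewrite -sqrf_eq0.
by apply: hx; rewrite mem_index_enum.
Qed.

Lemma norm2_0 n : norm2 (0 : 'cV[R]_n) = 0.
Proof. by rewrite /norm2 big1 ?sqrtr0 // => i _; rewrite mxE expr0n. Qed.

Lemma norm2Z n c (x : 'cV[R]_n) : norm2 (c *: x) = `|c| * norm2 x.
Proof.
rewrite /norm2 -sqrtr_sqr -sqrtrM ?sqr_ge0 // mulr_sumr.
by congr Num.sqrt; apply: eq_bigr => i _; rewrite mxE exprMn.
Qed.

Lemma norm2N n (x : 'cV[R]_n) : norm2 (- x) = norm2 x.
Proof. by rewrite -scaleN1r norm2Z normrN1 mul1r. Qed.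

Lemma dotE k (a b : 'cV[R]_k) : \sum_i a i 0 * b i 0 = (a^T *m b) 0 0.
Proof. by rewrite mxE; apply: eq_bigr => i _; rewrite mxE. Qed.

Lemma cauchy_schwarz n (x y : 'cV[R]_n) :
  \sum_i x i 0 * y i 0 <= norm2 x * norm2 y.
Proof.
have [/eqP/norm2_eq0 ->|x0] := boolP (norm2 x == 0).
  by rewrite norm2_0 mul0r big1 // => i _; rewrite mxE mul0r.
have [/eqP/norm2_eq0 ->|y0] := boolP (norm2 y == 0).
  by rewrite norm2_0 mulr0 big1 // => i _; rewrite mxE mulr0.
have a0 : 0 < norm2 x by rewrite lt_def x0 norm2_ge0.
have b0 : 0 < norm2 y by rewrite lt_def y0 norm2_ge0.
have := norm2_sqr x; have := norm2_sqr y.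
move: a0 b0; set a := norm2 x; set b := norm2 y => a0 b0 hb ha.
have ab0 : 0 < 2 * a * b by rewrite !mulr_gt0.
rewrite -(ler_pM2l ab0).
have -> : 2 * a * b * (a * b) = b ^+ 2 * a ^+ 2 + a ^+ 2 * b ^+ 2 by ring.
rewrite {1}ha {2}hb !mulr_sumr -big_split /=; apply: ler_sum => i _.
have := sqr_ge0 (b * x i 0 - a * y i 0); nra.
Qed.

Lemma norm2D n (x y : 'cV[R]_n) : norm2 (x + y) <= norm2 x + norm2 y.
Proof.
rewrite -(@ler_pXn2r _ 2) // ?nnegrE ?addr_ge0 ?norm2_ge0 //.
rewrite sqrrD !norm2_sqr.
under eq_bigr do rewrite mxE sqrrD.
rewrite big_split big_split /= lerD2r lerD2l sumrMnl lerMn2r /=; exact: cauchy_schwarz.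
Qed.

Lemma entry_le_norm2 n (x : 'cV[R]_n) i : `|x i 0| <= norm2 x.
Proof.
rewrite -(@ler_pXn2r _ 2) // ?nnegrE ?norm2_ge0 // norm2_sqr.
rewrite real_normK ?num_real // (bigD1 i) //= lerDl.
by apply: sumr_ge0 => j _; exact: sqr_ge0.
Qed.

Lemma norm2_le_sum n (x : 'cV[R]_n) : norm2 x <= \sum_i `|x i 0|.
Proof.
rewrite {1}(_ : x = \sum_i x i 0 *: delta_mx i 0); last first.
  rewrite {1}(matrix_sum_delta x); apply: eq_bigr => i _.
  by rewrite big_ord1.
elim/big_ind2 : _ => [|a b c d ab cd|i _]; first by rewrite norm2_0.
  exact: le_trans (norm2D _ _) (lerD ab cd).
rewrite norm2Z ler_piMr //.
rewrite /norm2 (bigD1 i) //= big1 => [|j /negbTE ji]; last by rewrite mxE ji expr0n.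
by rewrite mxE !eqxx expr1n addr0 sqrtr1.
Qed.

(** A bound on the operator norm, which unlike the supremum defining [mxnorm2]
needs no boundedness argument. *)
Definition opnorm_le (m n : nat) (c : R) (M : 'M[R]_(m, n)) : Prop :=
  forall x : 'cV[R]_n, norm2 (M *m x) <= c * norm2 x.

Lemma opnorm_le_weaken m n c c' (M : 'M[R]_(m, n)) : c <= c' -> opnorm_le c M -> opnorm_le c' M.
Proof. by move=> cc' h x; apply: le_trans (h x) _; rewrite ler_wpM2r ?norm2_ge0. Qed.

Lemma opnorm_leD m n c d (M P : 'M[R]_(m, n)) : opnorm_le c M -> opnorm_le d P -> opnorm_le (c + d) (M + P).
Proof.
move=> hM hP x; rewrite mulmxDl mulrDl.
by apply: le_trans (norm2D _ _) _; exact: lerD.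
Qed.

Lemma opnorm_leN m n c (M : 'M[R]_(m, n)) : opnorm_le c M -> opnorm_le c (- M).
Proof. by move=> hM x; rewrite mulNmx norm2N. Qed.

Lemma opnorm_leB m n c d (M P : 'M[R]_(m, n)) : opnorm_le c M -> opnorm_le d P -> opnorm_le (c + d) (M - P).
Proof. by move=> hM hP; apply: opnorm_leD => //; exact: opnorm_leN. Qed.

Lemma opnorm_leM m n p c d (M : 'M[R]_(m, n)) (P : 'M[R]_(n, p)) : 0 <= c ->
  opnorm_le c M -> opnorm_le d P -> opnorm_le (c * d) (M *m P).
Proof.
move=> c0 hM hP x; rewrite -mulmxA -mulrA.
by apply: le_trans (hM _) _; rewrite ler_wpM2l.
Qed.

Lemma opnorm_le1 n : opnorm_le 1 (1%:M : 'M[R]_n).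
Proof. by move=> x; rewrite mul1mx mul1r. Qed.

(** |M^T y|^2 = y . M M^T y <= |y| c |M^T y|. *)
Lemma opnorm_le_tr m n c (M : 'M[R]_(m, n)) : 0 <= c -> opnorm_le c M -> opnorm_le c M^T.
Proof.
move=> c0 hM y.
have [->|/eqP z0] := eqVneq (norm2 (M^T *m y)) 0.
  by rewrite mulr_ge0 ?norm2_ge0.
have z1 : 0 < norm2 (M^T *m y) by rewrite lt_def norm2_ge0 andbT; apply/eqP.
rewrite -(ler_pM2l z1) -expr2 norm2_sqr.
have -> : \sum_i (M^T *m y) i 0 ^+ 2 = \sum_i (M *m (M^T *m y)) i 0 * y i 0.
  under eq_bigr do rewrite expr2.
  by rewrite !dotE !trmx_mul trmxK !mulmxA.
apply: le_trans (cauchy_schwarz _ _) _.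
rewrite mulrCA mulrA ler_wpM2r ?norm2_ge0 //; exact: hM.
Qed.

Lemma opnorm_le_entry m n c (M : 'M[R]_(m, n)) i j : opnorm_le c M -> `|M i j| <= c.
Proof.
move=> hM; have := hM (delta_mx j 0).
have -> : norm2 (delta_mx j 0 : 'cV[R]_n) = 1.
  rewrite /norm2 (bigD1 j) //= big1 => [|k /negbTE ji]; last by rewrite mxE ji expr0n.
  by rewrite mxE !eqxx expr1n addr0 sqrtr1.
rewrite mulr1; apply: le_trans; rewrite -colE.
by apply: le_trans (entry_le_norm2 _ i); rewrite mxE.
Qed.

Lemma entry_opnorm_le m n (c : R) (M : 'M[R]_(m, n)) : 0 <= c ->
  (forall i j, `|M i j| <= c) -> opnorm_le (m%:R * n%:R * c) M.
Proof.
move=> c0 hM x; apply: le_trans (norm2_le_sum _) _.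
apply: (@le_trans _ _ (\sum_(i < m) \sum_(j < n) c * norm2 x)).
  apply: ler_sum => i _; rewrite mxE; apply: le_trans (ler_norm_sum _ _ _) _.
  by apply: ler_sum => j _; rewrite normrM ler_pM // entry_le_norm2.
by rewrite sumr_const card_ord sumr_const card_ord -!mulrA !mulr_natl.
Qed.

Lemma mxnorm2_opnorm_le m n (M : 'M[R]_(m, n)) e : mxnorm2 M <= e -> opnorm_le e M.
Proof.
move=> he x; apply: (@le_trans _ _ (mxnorm2 M * norm2 x)); last first.
  by rewrite ler_wpM2r ?norm2_ge0.
have hub : has_ubound [set norm2 (M *m x) | x in [set x : 'cV[R]_n | norm2 x <= 1]].
  pose c := \sum_i \sum_j `|M i j|.
  have c0 : 0 <= c by apply: sumr_ge0 => i _; exact: sumr_ge0.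
  exists (m%:R * n%:R * c) => _ [y /= y1 <-].
  apply: le_trans (entry_opnorm_le c0 _ y) _.
    move=> i j; rewrite /c (bigD1 i) //= (bigD1 j) //= -addrA lerDl.
    by rewrite addr_ge0 //; apply: sumr_ge0 => ? _ //; exact: sumr_ge0.
  by rewrite -[leRHS]mulr1 ler_wpM2l // !mulr_ge0.
have [/norm2_eq0 ->|/eqP x0] := eqVneq (norm2 x) 0.
  by rewrite mulmx0 !norm2_0 mulr0.
have x1 : 0 < norm2 x by rewrite lt_def norm2_ge0 andbT; apply/eqP.
rewrite -ler_pdivrMr //; apply: ub_le_sup => //.
exists ((norm2 x)^-1 *: x); rewrite /= ?norm2Z.
  by rewrite ger0_norm ?invr_ge0 ?norm2_ge0 // mulVf ?gt_eqF.
by rewrite -scalemxAr norm2Z ger0_norm ?invr_ge0 ?norm2_ge0 // mulrC.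
Qed.

Lemma gram_unit N d (B : 'M[R]_(N, d)) (b : R) : 0 < b ->
  (forall x, b * norm2 x <= norm2 (B^T *m B *m x)) -> B^T *m B \in unitmx.
Proof.
move=> b0 h; rewrite -unitmx_tr -row_free_unit -kermx_eq0.
set S := _^T; apply/eqP/row_matrixP => i; rewrite row0.
have /(congr1 trmx) : row i (kermx S) *m S = 0.
  by rewrite -row_mul mulmx_ker row0.
rewrite trmx0 trmx_mul trmxK => hi.
have := h (row i (kermx S))^T; rewrite hi norm2_0 pmulr_rle0 // => h0.
have /norm2_eq0 /(congr1 trmx) : norm2 (row i (kermx S))^T = 0.
  by apply/eqP; rewrite eq_le h0 norm2_ge0.
by rewrite trmxK trmx0.
Qed.

(** The eigenvalues of I - S/a, for the Gram matrix S, lie in [0, 1 - b/a], and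
the lower bound on |S x| follows from the resulting bound on |x - S x / a|.  In
particular S is invertible, so that B has at most as many columns as rows. *)
Lemma gram_bounds N d (B : 'M[R]_(N, d)) (a b : R) : 0 < a -> 0 < b -> b < a ->
  spectrum (B^T *m B) `<=` `[b, a]%classic ->
  [/\ forall x, norm2 (B *m x) ^+ 2 <= a * norm2 x ^+ 2, opnorm_le a (B^T *m B),
      opnorm_le (1 - b / a) (1%:M - a^-1 *: (B^T *m B)),
      (forall x, b * norm2 x <= norm2 (B^T *m B *m x)) &
      (d <= N)%N].
Proof.
move=> a0 b0 ba hs; set S := B^T *m B.
have symS : S^T = S by rewrite /S trmx_mul trmxK.
have hev r : eigenvalue S r -> b <= r <= a.
  by move=> /hs /=; rewrite in_itv.
have opS : opnorm_le a S.
  apply: symmetric_opnorm_le => //; first exact: ltW.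
  move=> r /hev /andP[h1 h2]; rewrite ger0_norm //; lra.
have ba1 : b / a < 1 by rewrite ltr_pdivrMr ?mul1r.
have op1 : opnorm_le (1 - b / a) (1%:M - a^-1 *: S).
  apply: symmetric_opnorm_le; first lra.
    by rewrite linearB /= trmx1 linearZ /= symS.
  move=> r /eigenvalueP [v hv v0].
  have /hev /andP[h1 h2] : eigenvalue S (a * (1 - r)).
    apply/eigenvalueP; exists v => //.
    move: hv; rewrite mulmxBr mulmx1 -scalemxAr => hv.
    have -> : v *m S = a *: (v - (v - a^-1 *: (v *m S))).
      by rewrite opprB addrC subrK scalerA divff ?scale1r // gt_eqF.
    by rewrite hv -scalerA scalerBl scale1r.
  have h3 : b / a <= 1 - r by rewrite ler_pdivrMr // mulrC.
  have h4 : 1 - r <= 1 by rewrite -(ler_pM2l a0) mulr1.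
  rewrite ger0_norm; lra.
have low x : b * norm2 x <= norm2 (S *m x).
  have := op1 x; rewrite mulmxBl mul1mx -scalemxAl => h.
  have : norm2 x <= norm2 (x - a^-1 *: (S *m x)) + norm2 (a^-1 *: (S *m x)).
    by rewrite -{1}(subrK (a^-1 *: (S *m x)) x); exact: norm2D.
  rewrite norm2Z ger0_norm ?invr_ge0 ?(ltW a0) // => h'.
  have : b / a * norm2 x <= a^-1 * norm2 (S *m x).
    move: h h'; rewrite mulrBl mul1r; lra.
  by rewrite mulrAC mulrC ler_pM2l // invr_gt0.
split => //.
- move=> x; rewrite norm2_sqr.
  have -> : \sum_i (B *m x) i 0 ^+ 2 = \sum_i x i 0 * (S *m x) i 0.
    under eq_bigr do rewrite expr2.
    by rewrite !dotE trmx_mul /S !mulmxA.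
  apply: le_trans (cauchy_schwarz _ _) _.
  by rewrite expr2 mulrCA ler_wpM2l ?norm2_ge0.
- have SU := gram_unit b0 low.
  have : (\rank S <= N)%N.
    by apply: leq_trans (mxrankM_maxr _ _) _; exact: rank_leq_row.
  by rewrite mxrank_unit.
Qed.

End Euclid.

(** * Approximate inversion and error analysis *)

Section Newton.
Variable R : realType.

Definition mulmx_approx (q : nat) (c : R) m n p (A : 'M[R]_(m, n)) (B : 'M[R]_(n, p)) :=
  \matrix_(i < m, j < p) \sum_k mul_approx q c (A i k) (B k j).

Lemma mul_approx_err_ge0 q (c : R) : 0 <= 2 * c ^+ 2 * 4^-1 ^+ q.
Proof. by apply: mulr_ge0; [apply: mulr_ge0; rewrite ?sqr_ge0 | apply: exprn_ge0; rewrite invr_ge0]. Qed.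

Lemma mulmx_approx_err q (c : R) m n p (A : 'M[R]_(m, n)) (B : 'M[R]_(n, p)) : 0 < c ->
  (forall i k, `|A i k| <= c) -> (forall k j, `|B k j| <= c) ->
  opnorm_le (m%:R * p%:R * (n%:R * (2 * c ^+ 2 * 4^-1 ^+ q))) (mulmx_approx q c A B - A *m B).
Proof.
move=> c0 hA hB; have e0 : 0 <= 2 * c ^+ 2 * 4^-1 ^+ q.
  by rewrite mulr_ge0 ?exprn_ge0 ?invr_ge0 // mulr_ge0 // sqr_ge0.
apply: entry_opnorm_le => [|i j]; first by rewrite mulr_ge0.
rewrite !mxE -sumrB; apply: le_trans (ler_norm_sum _ _ _) _.
apply: (@le_trans _ _ (\sum_(k < n) 2 * c ^+ 2 * 4^-1 ^+ q)).
  by apply: ler_sum => k _; exact: mul_approx_err.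
by rewrite sumr_const card_ord [leRHS]mulr_natl.
Qed.

Definition newton (q : nat) (c : R) d (S X : 'M[R]_d) : 'M[R]_d :=
  2 *: X - mulmx_approx q c X (mulmx_approx q c S X).

(** Without the errors E1 and E2 of the two products a Newton step squares the
residual I - S X; the errors enter additively. *)
Lemma newton_residual d (S X E1 E2 : 'M[R]_d) :
  1%:M - S *m (2 *: X - (X *m (S *m X + E1) + E2)) =
  (1%:M - S *m X) *m (1%:M - S *m X) + (S *m X *m E1 + S *m E2).
Proof.
rewrite !mulmxBr !mulmxBl !mulmxDr !mulmx1 !mul1mx -scalemxAr !mulmxA.
rewrite scaler_nat mulr2n.
set Y := S *m X; set Z := Y *m S *m X; set U := Y *m E1; set V := S *m E2.
rewrite !opprD !opprK !addrA.
by rewrite (addrAC _ Z) -!addrA; congr (_ + _); rewrite !addrA.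
Qed.

(** Squaring alone would keep the bound rho^(2^k), but a rounding error is added
at each step.  The factor 1 + kap leaves room for it: if u = (1 + kap) r bounds
the scaled residual, then a step gives u' <= u^2 / (1 + kap) + (1 + kap) w, where
w is the contribution of the rounding, and this is at most max(u, tau)^2 as soon
as w is of order tau^2.  So u follows rho^(2^k) down to the level tau and stays
there. *)
Lemma newton_iter q (c : R) d (S X0 : 'M[R]_d) (b cS rho kap tau : R) :
  0 < b -> 0 < cS -> cS <= c -> 2 / b <= c -> 3 <= c ->
  0 < kap -> 0 < tau -> tau <= 1 -> 0 < rho -> rho <= 1 ->
  let eta := d%:R * d%:R * (d%:R * (2 * c ^+ 2 * 4^-1 ^+ q)) in
  eta <= 1 -> (1 + kap) ^+ 2 * ((cS * c + cS) * eta) <= kap * tau ^+ 2 ->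
  opnorm_le cS S -> (forall x, b * norm2 x <= norm2 (S *m x)) ->
  opnorm_le (rho / (1 + kap)) (1%:M - S *m X0) ->
  forall k, let X := iter k (newton q c S) X0 in
    opnorm_le (2 / b) X /\ opnorm_le (Num.max (rho ^+ (2 ^ k)) tau) (1%:M - S *m X).
Proof.
move=> b0 cS0 cSc bc c3 k0 t0 t1 r0 r1 eta eta1 hw hS hb h0.
have c0 : 0 < c by lra.
have eta0 : 0 <= eta.
  by rewrite /eta !mulr_ge0 ?ler0n ?exprn_ge0 ?invr_ge0 // ltW.
have kp : 0 < 1 + kap by lra.
have Xbd (X : 'M[R]_d) r : r <= 1 -> opnorm_le r (1%:M - S *m X) -> opnorm_le (2 / b) X.
  move=> r2 hr x; rewrite mulrAC ler_pdivlMr // mulrC.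
  apply: le_trans (hb _) _; rewrite mulmxA.
  have -> : S *m X *m x = x - (1%:M - S *m X) *m x.
    by rewrite mulmxBl mul1mx opprB addrC subrK.
  apply: le_trans (norm2D _ _) _; rewrite norm2N.
  have := hr x; have := norm2_ge0 x; nra.
pose M k := Num.max (rho ^+ (2 ^ k)) tau.
have M0 k : tau <= M k by rewrite /M le_max lexx orbT.
have Mge0 k : 0 <= M k by apply: le_trans (M0 k); exact: ltW.
have M1 k : M k <= 1 by rewrite /M ge_max t1 andbT exprn_ile1 // ltW.
have MS k : M k ^+ 2 <= M k.+1.
  have [h|h] := leP (rho ^+ (2 ^ k)) tau.
    rewrite /M (max_r h) le_max; apply/orP; right; nra.
  by rewrite /M (max_l (ltW h)) -exprM -expnSr le_max lexx.
suff main k : exists r : R, [/\ 0 <= r, opnorm_le r (1%:M - S *m iter k (newton q c S) X0)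
    & (1 + kap) * r <= M k].
  move=> k X; have [r [rr hr hM]] := main k.
  have rM : r <= M k by apply: le_trans hM; nra.
  split; last exact: opnorm_le_weaken hr.
  by apply: Xbd hr; apply: le_trans rM _.
elim: k => [|k [r [rr hr hM]]].
  exists (rho / (1 + kap)); split => //; first by rewrite divr_ge0 // ltW.
  by rewrite mulrC divfK ?gt_eqF // /M expn0 expr1 le_max lexx.
set X := iter k _ _ in hr *.
have rM : r <= 1 by apply: le_trans (M1 k); apply: le_trans hM; nra.
have hX := Xbd _ _ rM hr.
have Sc i j : `|S i j| <= c by apply: le_trans cSc; exact: opnorm_le_entry hS.
have Xc i j : `|X i j| <= c by apply: le_trans bc; exact: opnorm_le_entry hX.
have hE1 := mulmx_approx_err q c0 Sc Xc; rewrite -/eta in hE1.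
set Y := mulmx_approx q c S X in hE1.
have Yc i j : `|Y i j| <= c.
  apply: le_trans c3; apply: (@opnorm_le_entry _ _ _ _ Y).
  have -> : Y = 1%:M - (1%:M - S *m X) + (Y - S *m X).
    by rewrite subKr addrC subrK.
  apply: opnorm_le_weaken (opnorm_leD (opnorm_leB (@opnorm_le1 _ d) hr) hE1); lra.
have hE2 := mulmx_approx_err q c0 Xc Yc; rewrite -/eta in hE2.
exists (r * r + (cS * (2 / b) * eta + cS * eta)); split.
- by rewrite !addr_ge0 ?mulr_ge0 // ?invr_ge0 ltW.
- rewrite iterS -/X /newton -/Y.
  have -> : 2 *: X - mulmx_approx q c X Y = 2 *: X -
      (X *m (S *m X + (Y - S *m X)) + (mulmx_approx q c X Y - X *m Y)).
    by rewrite [S *m X + _]addrC subrK [X *m Y + _]addrC subrK.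
  rewrite newton_residual; apply: opnorm_leD; first exact: opnorm_leM.
  apply: opnorm_leD; last by apply: opnorm_leM => //; exact: ltW.
  apply: opnorm_leM hE1; first by rewrite mulr_ge0 // ?divr_ge0 // ltW.
  by apply: opnorm_leM => //; exact: ltW.
- apply: le_trans (MS k).
  have hw2 : (1 + kap) ^+ 2 * (cS * (2 / b) * eta + cS * eta) <= kap * M k ^+ 2.
    apply: (@le_trans _ _ ((1 + kap) ^+ 2 * ((cS * c + cS) * eta))).
      apply: ler_wpM2l; first exact: sqr_ge0.
      rewrite [leRHS]mulrDl lerD2r ler_wpM2r // ler_wpM2l //; exact: ltW.
    apply: le_trans hw _; rewrite ler_wpM2l //; first exact: ltW.
    by rewrite ler_pXn2r // ?nnegrE ?Mge0 ?(ltW t0).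
  move: hw2; set w := _ + cS * eta => hw2.
  rewrite -(ler_pM2l kp) mulrA -expr2 mulrDr.
  have : ((1 + kap) * r) ^+ 2 <= M k ^+ 2.
    by rewrite ler_pXn2r // nnegrE ?mulr_ge0 ?(ltW kp).
  rewrite exprMn -[r * r]expr2; lra.
Qed.

Lemma opnorm_le_col n c (x : 'cV[R]_n) : opnorm_le c x -> norm2 x <= c.
Proof.
move=> /(_ 1%:M); rewrite mulmx1 => /le_trans; apply.
by rewrite /norm2 big_ord1 mxE eqxx expr1n sqrtr1 mulr1.
Qed.

Lemma opnorm_le_norm2 n m (c r : R) (M : 'M[R]_(m, n)) (x : 'cV[R]_n) : 0 <= c ->
  opnorm_le c M -> norm2 x <= r -> norm2 (M *m x) <= c * r.
Proof. by move=> c0 hM hx; apply: le_trans (hM x) _; rewrite ler_wpM2l. Qed.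

(** A common bound for the entries of all matrices and vectors that are
multiplied by the network; it is the range of the product networks. *)
Definition entry_range (alpha beta gamma : R) : R :=
  3 + 2 * alpha + 2 * gamma + 2 * alpha ^+ 2 + 3 / beta ^+ 2 + 2 * (alpha * gamma).
(** The rounding errors admissible in the products involving N (relative to e),
the residual admissible after the last Newton step (e / tol2), and the rounding
errors admissible in the d x d products (relative to e^2) are governed by [tol1],
[tol2] and [tol3].  Each is a sum of positive terms, one for every requirement. *)
Definition tol1 (alpha beta gamma : R) : R :=
  18 / beta ^+ 2 + 3 / (alpha * gamma) +
  8 * (1 / beta ^+ 2 + 6 * (alpha * gamma) / beta ^+ 4).
Definition tol2 (alpha beta gamma : R) : R := 1 + 16 * (alpha * gamma) / beta ^+ 2.
(** With t = beta^2 / alpha^2, the exact residual of alpha^-2 I is at most 1 - t.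
Perturbing the Gram matrix by beta^2 / 3 raises it to 1 - 2t/3, and with
gap = t/3 this is at most (1 - gap) / (1 + gap), as [newton_iter] requires. *)
Definition gap (alpha beta : R) : R := beta ^+ 2 / alpha ^+ 2 / 3.
Definition tol3 (alpha beta gamma : R) : R :=
  8 + (1 + gap alpha beta) ^+ 2 *
      (2 * alpha ^+ 2 * entry_range alpha beta gamma + 2 * alpha ^+ 2) *
      tol2 alpha beta gamma ^+ 2 / gap alpha beta.

Lemma gram_perturb N d (B : 'M[R]_(N, d)) (S3 : 'M[R]_d) (a b r : R) :
  let kap := b / a / 3 in
  0 < a -> 0 < b -> b < a -> spectrum (B^T *m B) `<=` `[b, a]%classic ->
  0 <= r -> r <= b / 3 -> opnorm_le r (S3 - B^T *m B) ->
  [/\ opnorm_le (2 * a) S3, forall x, 2 / 3 * b * norm2 x <= norm2 (S3 *m x) &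
      opnorm_le ((1 - kap) / (1 + kap)) (1%:M - S3 *m (a^-1)%:M)].
Proof.
move=> kap a0 b0 ba hsp r0 rb hE.
have [_ opS op1 low _] := gram_bounds a0 b0 ba hsp.
move: (B^T *m B) opS op1 low hE => S opS op1 low hE {hsp}.
have gapE : b / a = 3 * kap by rewrite /kap; field; rewrite gt_eqF.
have kap0 : 0 < kap by rewrite /kap !divr_gt0.
have kap1 : 3 * kap < 1 by rewrite -gapE ltr_pdivrMr ?mul1r.
have ark : a^-1 * r <= kap by rewrite mulrC ler_pdivrMr // /kap mulrAC divfK // gt_eqF.
clearbody kap; split.
- rewrite -(subrK S S3); apply: opnorm_le_weaken (opnorm_leD hE opS); lra.
- move=> x; have hx : norm2 (S *m x) <= norm2 (S3 *m x) + norm2 ((S3 - S) *m x).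
    by rewrite -[in leLHS](subKr S3 S) mulmxBl; apply: le_trans (norm2D _ _) _; rewrite norm2N.
  have := low x; have := hE x; have := ler_wpM2r (norm2_ge0 x) rb; lra.
- have -> : 1%:M - S3 *m (a^-1)%:M = (1%:M - a^-1 *: S) - (a^-1)%:M *m (S3 - S).
    by rewrite mul_mx_scalar mul_scalar_mx scalerBr -addrA -opprD [_ *: S + _]addrC subrK.
  have ia0 : 0 <= a^-1 by rewrite invr_ge0 ltW.
  have opt : opnorm_le a^-1 ((a^-1)%:M : 'M[R]_d).
    by move=> x; rewrite mul_scalar_mx norm2Z ger0_norm.
  apply: opnorm_le_weaken (opnorm_leB op1 (opnorm_leM ia0 opt hE)).
  rewrite gapE ler_pdivlMr; [nra|lra].
Qed.

(** With S z = w, the vector S (z - X v) is the sum of w - v, of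
(I - S3 X) v and of (S3 - S) X v. *)
Lemma solve_perturb d (S S3 X : 'M[R]_d) (z w v : 'cV[R]_d) (b tau r : R) :
  0 < b -> 0 <= r -> (forall x, b * norm2 x <= norm2 (S *m x)) -> S *m z = w ->
  opnorm_le tau (1%:M - S3 *m X) -> opnorm_le r (S3 - S) -> opnorm_le (3 / b) X ->
  b ^+ 2 * norm2 (z - X *m v) <=
  b * norm2 (w - v) + b * (tau * norm2 v) + 3 * (r * norm2 v).
Proof.
move=> b0 r0 low Sz hr hE hX.
have key : b * norm2 (z - X *m v) <=
    norm2 (w - v) + tau * norm2 v + r * (3 / b * norm2 v).
  apply: le_trans (low _) _.
  have -> : S *m (z - X *m v) = (w - v) + (1%:M - S3 *m X) *m v + (S3 - S) *m (X *m v).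
    rewrite mulmxBr Sz !mulmxBl mul1mx !mulmxA.
    by rewrite !addrA !subrK.
  apply: le_trans (norm2D _ _) _; apply: lerD.
    by apply: le_trans (norm2D _ _) _; apply: lerD.
  apply: opnorm_le_norm2 => //; exact: hX.
have := ler_wpM2l (ltW b0) key; rewrite [b * (b * _)]mulrA -expr2 => /le_trans; apply.
rewrite le_eqVlt; apply/orP; left; apply/eqP; field; by rewrite gt_eqF.
Qed.

(** Here b, p, n and nv stand for beta^2, alpha gamma, |z - X v| and |v|.  In
units of e, the right-hand side contributes 11/48, the Gram matrix 7/48, and the
residual and the rounding 1/8 each. *)
Lemma error_budget (e b p n nwv nv tau r r3 eta : R) :
  0 < b -> 0 < e -> 0 <= tau -> 0 <= r ->
  b ^+ 2 * n <= b * nwv + b * (tau * nv) + 3 * (r * nv) ->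
  nwv <= 11 / 48 * (e * b) + eta -> nv <= 2 * p ->
  tau * (16 * p) <= e * b -> r = r3 + eta -> r3 * p <= 7 / 288 * e * b ^+ 2 ->
  8 * (eta * b + 6 * eta * p) <= e * b ^+ 2 ->
  n <= 7 / 8 * e.
Proof.
move=> b0 e0 tau0 r0 key hwv hv ht rE hr3 heta.
have m1 := ler_wpM2l (ltW b0) (ler_wpM2l tau0 hv).
have m2 := ler_wpM2l r0 hv.
have n1 := ler_wpM2l (ltW b0) ht; have n4 := ler_wpM2l (ltW b0) hwv.
have bb : 0 < b ^+ 2 by rewrite exprn_gt0.
have eb : 0 < e * b ^+ 2 by rewrite mulr_gt0.
rewrite -(ler_pM2l bb); apply: le_trans key _.
rewrite rE in m2 *; rewrite !expr2 in hr3 heta eb *; lra.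
Qed.

Lemma tol1_split (alpha beta gamma eta e : R) : 0 < alpha -> 0 < beta -> 0 < gamma ->
  0 <= eta -> e <= 1 -> eta * tol1 alpha beta gamma <= e ->
  [/\ eta * 18 <= beta ^+ 2, eta * 3 <= alpha * gamma &
   8 * (eta * beta ^+ 2 + 6 * eta * (alpha * gamma)) <= e * (beta ^+ 2) ^+ 2].
Proof.
move=> a0 b0 g0 eta0 e1 hq.
have B20 : 0 < beta ^+ 2 by rewrite exprn_gt0.
have ag0 : 0 < alpha * gamma by rewrite mulr_gt0.
have B40 : 0 < beta ^+ 4 by rewrite exprn_gt0.
have P3 : 0 < 1 / beta ^+ 2 + 6 * (alpha * gamma) / beta ^+ 4.
  by rewrite addr_gt0 ?divr_gt0 // mulr_gt0.
have p1 : 0 <= eta * (18 / beta ^+ 2) by rewrite mulr_ge0 // divr_ge0 // ltW.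
have p2 : 0 <= eta * (3 / (alpha * gamma)) by rewrite mulr_ge0 // divr_ge0 // ltW.
have p3 : 0 <= eta * (1 / beta ^+ 2 + 6 * (alpha * gamma) / beta ^+ 4).
  by apply: mulr_ge0 => //; exact: ltW.
have expand (x r s t : R) : x * (r + s + 8 * t) = x * r + x * s + 8 * (x * t) by ring.
move: hq; rewrite /tol1 expand => hq; split.
- by rewrite -[leRHS]mul1r -ler_pdivrMr // -mulrA; lra.
- by rewrite -[leRHS]mul1r -ler_pdivrMr // -mulrA; lra.
- rewrite -exprM.
  have : 8 * (eta * (1 / beta ^+ 2 + 6 * (alpha * gamma) / beta ^+ 4)) <= e.
    by apply: le_trans hq; rewrite lerDr addr_ge0.
  move/(ler_wpM2r (ltW B40)); apply: le_trans.
  by rewrite le_eqVlt; apply/orP; left; apply/eqP; field; rewrite gt_eqF.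
Qed.

Lemma tol2_split (alpha beta gamma e : R) : 0 < alpha -> 0 < beta -> 0 < gamma ->
  0 < e <= 1 -> let tau := e / tol2 alpha beta gamma in
  [/\ 0 < tau, tau <= 1 & tau * (16 * (alpha * gamma)) <= e * beta ^+ 2].
Proof.
move=> a0 b0 g0 /andP[e0 e1] tau.
have B20 : 0 < beta ^+ 2 by rewrite exprn_gt0.
have q0 : 0 < 16 * (alpha * gamma) / beta ^+ 2 by rewrite divr_gt0 // !mulr_gt0.
have T2 : 1 < tol2 alpha beta gamma by rewrite /tol2 ltrDl.
have T0 : 0 < tol2 alpha beta gamma by lra.
have tau0 : 0 < tau by rewrite divr_gt0.
split => //; first by rewrite /tau ler_pdivrMr // mul1r; lra.
rewrite -ler_pdivrMr // -mulrA -[leRHS](divfK (lt0r_neq0 T0)) -/tau.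
by rewrite ler_pM2l // /tol2 lerDr.
Qed.

Lemma tol3_split (alpha beta gamma e eta : R) :
  0 < alpha -> 0 < beta -> 0 < gamma -> 0 <= eta ->
  let kap := gap alpha beta in let cS := 2 * alpha ^+ 2 in
  eta * tol3 alpha beta gamma <= e ^+ 2 ->
  8 * eta <= e ^+ 2 /\
  (1 + kap) ^+ 2 * ((cS * entry_range alpha beta gamma + cS) * eta) <=
    kap * (e / tol2 alpha beta gamma) ^+ 2.
Proof.
move=> a0 b0 g0 eta0 kap cS.
have A20 : 0 < alpha ^+ 2 by rewrite exprn_gt0.
have B20 : 0 < beta ^+ 2 by rewrite exprn_gt0.
have c0 : 0 < entry_range alpha beta gamma.
  by rewrite /entry_range !addr_gt0 ?divr_gt0 ?mulr_gt0.
have T2 : 0 < tol2 alpha beta gamma.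
  by rewrite /tol2 addr_gt0 // divr_gt0 // !mulr_gt0.
have cS0 : 0 < cS by rewrite /cS mulr_gt0.
have kap0 : 0 < kap by rewrite /kap /gap !divr_gt0.
rewrite /tol3 -/kap -/cS; move: kap (entry_range _ _ _) (tol2 _ _ _) cS kap0 c0 T2 cS0 => kap c t cS kap0 c0 t0 cS0.
set G := (1 + kap) ^+ 2 * (cS * c + cS); rewrite mulrDr => hq.
have G0 : 0 < G by apply: mulr_gt0; [apply: exprn_gt0; lra | rewrite addr_gt0 // mulr_gt0].
have p0 : 0 <= eta * (G * t ^+ 2 / kap).
  apply: mulr_ge0 => //; apply: ltW; apply: divr_gt0 => //; apply: mulr_gt0 => //.
  exact: exprn_gt0.
split; first lra.
rewrite mulrA -/G expr_div_n mulrA ler_pdivlMr ?exprn_gt0 //.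
have : eta * (G * t ^+ 2 / kap) <= e ^+ 2 by lra.
rewrite mulrA ler_pdivrMr //; clearbody G; lra.
Qed.

(** The approximations of B and f perturb the right-hand side B^T f by
e1 gamma + alpha e2 + e1 e2 <= (11/48) e beta^2 and the Gram matrix by
2 alpha e3 + e3^2, which the bound on e3 makes small compared with beta^2 and
with e.  The approximate inverse X satisfies |X| <= 3 / beta^2, so both
perturbations are amplified by constants only. *)
Lemma solve_error q1 q2 m N d (B B1 B3 : 'M[R]_(N, d)) (f f1 : 'cV[R]_N)
    (alpha beta gamma e e1 e2 e3 : R) :
  let c := entry_range alpha beta gamma in
  let S3 := mulmx_approx q1 c B3^T B3 in
  let X := iter m (newton q2 c S3) ((alpha ^+ 2)^-1)%:M in
  let v := mulmx_approx q1 c B1^T f1 in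
  0 < alpha -> 0 < beta -> 0 < gamma -> beta ^+ 2 < alpha ^+ 2 -> 0 < e <= 1 ->
  (0 < d)%N -> spectrum (B^T *m B) `<=` `[beta ^+ 2, alpha ^+ 2]%classic ->
  norm2 f <= gamma ->
  opnorm_le e1 (B - B1) -> norm2 (f - f1) <= e2 -> opnorm_le e3 (B - B3) ->
  0 <= e1 <= alpha / 4 -> 0 <= e2 <= gamma / 4 -> 0 <= e3 <= beta / 3 ->
  e1 * gamma <= e * beta ^+ 2 / 12 -> alpha * e2 <= e * beta ^+ 2 / 12 ->
  e1 * e2 <= beta ^+ 2 * e / 16 ->
  2 * alpha * e3 + e3 ^+ 2 <= 5 / 18 * beta ^+ 2 ->
  (2 * alpha * e3 + e3 ^+ 2) * (alpha * gamma) <= 7 / 288 * e * (beta ^+ 2) ^+ 2 ->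
  N%:R ^+ 3 * (2 * c ^+ 2 * 4^-1 ^+ q1) * tol1 alpha beta gamma <= e ->
  d%:R ^+ 3 * (2 * c ^+ 2 * 4^-1 ^+ q2) * tol3 alpha beta gamma <= e ^+ 2 ->
  (1 - gap alpha beta) ^+ (2 ^ m) * tol2 alpha beta gamma <= e ->
  norm2 (invmx (B^T *m B) *m B^T *m f - mulmx_approx q2 c X v) <= e.
Proof.
move=> c S3 X v a0 b0 g0 ba he d0 hsp hf hB1 hf1 hB3.
move=> /andP[e10 e1a] /andP[e20 e2g] /andP[e30 e3b] he1 he2 he12 he3 he3' hq1 hq2 hm.
have [t0 t1 tP] := tol2_split a0 b0 g0 he.
set tau := e / tol2 alpha beta gamma in t0 t1 tP.
have T2 : 0 < tol2 alpha beta gamma by rewrite -(pmulr_rgt0 _ t0) divfK; [case/andP: he|apply/eqP => h; move: t0; rewrite /tau h invr0 mulr0 ltxx].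
have {}hm : (1 - gap alpha beta) ^+ (2 ^ m) <= tau by rewrite ler_pdivlMr.
case/andP: he => e0 e_1.
have A20 : 0 < alpha ^+ 2 by rewrite exprn_gt0.
have B20 : 0 < beta ^+ 2 by rewrite exprn_gt0.
have ag0 : 0 < alpha * gamma by rewrite mulr_gt0.
have ba1 : beta <= alpha by rewrite -(@ler_pXn2r _ 2) ?nnegrE ?ltW.
have iB20 : 0 < 3 / beta ^+ 2 by rewrite divr_gt0.
have [hBx _ _ low dN] := gram_bounds A20 B20 ba hsp.
have [c3 ca cg] : [/\ 3 <= c, 2 * alpha <= c & 2 * gamma <= c].
  by rewrite /c /entry_range; split; lra.
have [cA cX cv] : [/\ 2 * alpha ^+ 2 <= c, 3 / beta ^+ 2 <= c & 2 * (alpha * gamma) <= c].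
  by rewrite /c /entry_range; split; lra.
have c0 : 0 < c by lra.
have h10 := mul_approx_err_ge0 q1 c; have h20 := mul_approx_err_ge0 q2 c.
have err1 m' p' (Y : 'M[R]_(m', N)) (Z : 'M[R]_(N, p')) := @mulmx_approx_err q1 c _ _ _ Y Z c0.
have err2 m' p' (Y : 'M[R]_(m', d)) (Z : 'M[R]_(d, p')) := @mulmx_approx_err q2 c _ _ _ Y Z c0.
have newt := @newton_iter q2 c d S3 ((alpha ^+ 2)^-1)%:M.
move: (2 * c ^+ 2 * 4^-1 ^+ q1) (2 * c ^+ 2 * 4^-1 ^+ q2) h10 h20 err1 err2 newt hq1 hq2.
move=> h1 h2 h10 h20 err1 err2 newt hq1 hq2.
have dN' : d%:R <= N%:R :> R by rewrite ler_nat.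
have d1 : 1 <= d%:R :> R by rewrite ler1n.
have cube (D M H : R) : 0 <= D -> D <= M -> 0 <= H -> D * D * (M * H) <= M ^+ 3 * H.
  move=> D0 DM H0; have M0 := le_trans D0 DM.
  rewrite mulrA; apply: ler_wpM2r => //.
  by rewrite !exprS expr0 mulr1 mulrA; apply: ler_wpM2r => //; exact: ler_pM.
have cube1 (D M H : R) : 1 <= D -> D <= M -> 0 <= H -> D * 1 * (M * H) <= M ^+ 3 * H.
  move=> D1 DM H0; have D0 : 0 <= D by lra.
  have M0 := le_trans D0 DM.
  apply: le_trans (cube D M H D0 DM H0); apply: ler_wpM2r; first exact: mulr_ge0.
  by apply: ler_wpM2l.
have dd1 := cube _ _ _ (ler0n _ _) dN' h10; have dd2 := cube1 _ _ _ d1 dN' h10.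
have dd3 := cube d%:R _ _ (ler0n _ _) (lexx _) h20; have dd4 := cube1 _ _ _ d1 (lexx _) h20.
have eta10 : 0 <= N%:R ^+ 3 * h1 by rewrite mulr_ge0 // exprn_ge0 ?ler0n.
have eta20 : 0 <= d%:R ^+ 3 * h2 by rewrite mulr_ge0 // exprn_ge0 ?ler0n.
move: (N%:R ^+ 3 * h1) (d%:R ^+ 3 * h2) dd1 dd2 dd3 dd4 hq1 hq2 eta10 eta20.
move=> eta1 eta2 dd1 dd2 dd3 dd4 hq1 hq2 eta10 eta20.
have [s1 s2 s3] := tol1_split a0 b0 g0 eta10 e_1 hq1.
have [u1 u2] := tol3_split a0 b0 g0 eta20 hq2.
rewrite -/c -/tau in u2.
have kE : beta ^+ 2 / alpha ^+ 2 / 3 = gap alpha beta by [].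
have k0 : 0 < gap alpha beta by rewrite /gap !divr_gt0.
have k1 : 3 * gap alpha beta < 1.
  have -> : 3 * gap alpha beta = beta ^+ 2 / alpha ^+ 2 by rewrite /gap; field; rewrite gt_eqF.
  by rewrite ltr_pdivrMr // mul1r.
have SU := gram_unit B20 low.
have hB : opnorm_le alpha B.
  move=> x; rewrite -(@ler_pXn2r _ 2) // ?nnegrE ?mulr_ge0 ?norm2_ge0 ?(ltW a0) //.
  by rewrite exprMn; exact: hBx.
have hBT : opnorm_le alpha B^T by apply: opnorm_le_tr => //; exact: ltW.
have ae1 : 0 <= alpha + e1 by rewrite addr_ge0 // ltW.
have ae3 : 0 <= alpha + e3 by rewrite addr_ge0 // ltW.
have hB1' : opnorm_le (alpha + e1) B1^T.
  by apply: opnorm_le_tr => //; rewrite -(subKr B B1); exact: opnorm_leB.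
have hB3' : opnorm_le (alpha + e3) B3.
  by rewrite -(subKr B B3); exact: opnorm_leB.
have hf1' : norm2 f1 <= gamma + e2.
  by rewrite -(subKr f f1); apply: le_trans (norm2D _ _) _; rewrite norm2N lerD.
set r3 := 2 * alpha * e3 + e3 ^+ 2 in he3 he3'.
have r30 : 0 <= r3 by rewrite /r3 addr_ge0 ?sqr_ge0 // mulr_ge0 // mulr_ge0 // ltW.
have hE : opnorm_le (r3 + eta1) (S3 - B^T *m B).
  have -> : S3 - B^T *m B = B3^T *m (- (B - B3)) + (- (B - B3))^T *m B + (S3 - B3^T *m B3).
    rewrite opprB mulmxBr [(B3 - B)^T]linearB /= mulmxBl [_ + (S3 - _)]addrC.
    by rewrite !addrA !subrK.
  apply: opnorm_leD; last first.
    apply: opnorm_le_weaken dd1 _; apply: err1 => i k; rewrite ?mxE;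
      by apply: le_trans (opnorm_le_entry _ _ hB3') _; lra.
  apply: opnorm_le_weaken (opnorm_leD (opnorm_leM ae3 (opnorm_le_tr ae3 hB3') (opnorm_leN hB3)) (opnorm_leM e30 (opnorm_le_tr e30 (opnorm_leN hB3)) hB)).
  by rewrite le_eqVlt; apply/orP; left; apply/eqP; rewrite /r3; ring.
clearbody r3.
have rr0 : 0 <= r3 + eta1 by rewrite addr_ge0.
have rr1 : r3 + eta1 <= beta ^+ 2 / 3 by lra.
have [hS3 low3 res0] := gram_perturb A20 B20 ba hsp rr0 rr1 hE; rewrite kE in res0.
have b3E : 2 / (2 / 3 * beta ^+ 2) = 3 / beta ^+ 2 by field; rewrite gt_eqF.
have [hX hr] : opnorm_le (3 / beta ^+ 2) X /\ opnorm_le tau (1%:M - S3 *m X).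
  rewrite -b3E.
  have [|||||||||||| hX hr] := newt (2 / 3 * beta ^+ 2) (2 * alpha ^+ 2) (1 - gap alpha beta) (gap alpha beta) tau _ _ _ _ _ _ _ _ _ _ _ _ hS3 low3 res0 m => //.
  - by rewrite mulr_gt0 // divr_gt0.
  - by rewrite mulr_gt0.
  - by rewrite b3E.
  - lra.
  - lra.
  - apply: le_trans dd3 _; nra.
  - apply: le_trans u2; rewrite ler_wpM2l ?sqr_ge0 // ler_wpM2l //.
    by rewrite addr_ge0 // ?mulr_ge0 // ltW.
  - by rewrite (max_r hm) in hr.
clear newt res0 u2.
have hv : norm2 (v - B1^T *m f1) <= eta1.
  apply: le_trans dd2; apply: opnorm_le_col; apply: err1 => [i k|k j].
    by apply: le_trans (opnorm_le_entry _ _ hB1') _; lra.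
  rewrite (ord1 j); apply: le_trans (entry_le_norm2 _ _) _.
  by apply: le_trans hf1' _; lra.
have hwv1 : norm2 (B^T *m f - B1^T *m f1) <= e1 * gamma + (alpha + e1) * e2.
  have -> : B^T *m f - B1^T *m f1 = (B - B1)^T *m f + B1^T *m (f - f1).
    by rewrite [(B - B1)^T]linearB /= mulmxBl mulmxBr addrA subrK.
  apply: le_trans (norm2D _ _) _; apply: lerD; apply: opnorm_le_norm2 => //; exact: opnorm_le_tr.
have hwv : norm2 (B^T *m f - v) <= e1 * gamma + (alpha + e1) * e2 + eta1.
  have -> : B^T *m f - v = (B^T *m f - B1^T *m f1) - (v - B1^T *m f1) by rewrite opprB addrA subrK.
  by apply: le_trans (norm2D _ _) _; rewrite norm2N lerD.
have hw : norm2 (B^T *m f) <= alpha * gamma by apply: opnorm_le_norm2 hf => //; exact: ltW.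
have hv2 : norm2 v <= 2 * (alpha * gamma).
  rewrite -(subKr (B^T *m f) v); apply: le_trans (norm2D _ _) _; rewrite norm2N.
  apply: le_trans (lerD hw hwv) _.
  have f1g : e1 * gamma <= alpha / 4 * gamma by rewrite ler_wpM2r // ltW.
  have f2g : (alpha + e1) * e2 <= (alpha + alpha / 4) * (gamma / 4) by apply: ler_pM => //; lra.
  lra.
have vc k : `|v k 0| <= c.
  by apply: le_trans (entry_le_norm2 _ _) _; apply: le_trans hv2 _.
have hout : norm2 (mulmx_approx q2 c X v - X *m v) <= eta2.
  apply: le_trans dd4; apply: opnorm_le_col; apply: err2 => [i k|k j]; last by rewrite (ord1 j).
  exact: le_trans (opnorm_le_entry _ _ hX) _.
set z := invmx _ *m B^T *m f.
have Sz : B^T *m B *m z = B^T *m f by rewrite /z -[invmx _ *m _ *m _]mulmxA mulKVmx.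
have key := solve_perturb v B20 rr0 low Sz hr hE hX.
have fin : norm2 (z - X *m v) <= 7 / 8 * e.
  apply: (error_budget B20 e0 (ltW t0) rr0 key _ hv2 tP erefl he3' s3).
  apply: le_trans hwv _; rewrite lerD2r; lra.
have -> : z - mulmx_approx q2 c X v = (z - X *m v) - (mulmx_approx q2 c X v - X *m v).
  by rewrite opprB addrA subrK.
apply: le_trans (norm2D _ _) _; rewrite norm2N.
have : e ^+ 2 <= e by rewrite expr2 ler_piMr // ltW.
lra.
Qed.
End Newton.

(** * The network solving the normal equations *)

Section Assembly.
Variable R : realType.

Definition entries m n (M : 'M[R]_(m, n)) : 'I_m * 'I_n -> R := fun ij => M ij.1 ij.2.
Definition of_entries m n (u : 'I_m * 'I_n -> R) : 'M[R]_(m, n) := \matrix_(i, j) u (i, j).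
Definition col_of n (u : 'I_n -> R) : 'cV[R]_n := \col_i u i.

Lemma col_ofK n (x : 'cV[R]_n) : col_of (x^~ 0) = x.
Proof. by apply/matrixP => i j; rewrite mxE (ord1 j). Qed.

Lemma of_entriesK m n (M : 'M[R]_(m, n)) : of_entries (entries M) = M.
Proof. by apply/matrixP => i j; rewrite mxE. Qed.

(** The entries of [matr v] are those of v up to a bijection of indices. *)
Lemma net_matr h p N d (Psi : network R p (d * N)) : (layers Psi).-1 = h ->
  net h (fun u => entries (matr (realization Psi (col_of u)))) (weights Psi).
Proof.
move=> <-; pose s (ij : 'I_N * 'I_d) := mxvec_index ij.2 ij.1.
have sI : injective s.
  have [g gK _] := curry_mxvec_bij d N.
  move=> [i j] [i' j'] /= e.
  have gE a b : g (mxvec_index a b) = (a, b) by exact: (gK (a, b) isT).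
  by have := congr1 g e; rewrite /s !gE => -[-> ->].
apply: net_ext (net_reindex_output sI (net_of_network Psi)) => u [i j].
by rewrite /entries /matr mxE /vec_mx !mxE.
Qed.

Lemma net_mulmx_l q c N d : (0 < N)%N ->
  net q.+1 (fun u : 'I_N * 'I_d + 'I_N -> R => fun j : 'I_d =>
      mulmx_approx q c (of_entries (fun ij => u (inl ij)))^T (col_of (fun i => u (inr i))) j 0)
    (102 * q.+1 * (d * N)).
Proof.
move=> N0; have T0 : (0 < #|'I_N|)%N by rewrite card_ord.
have := @net_quadratic R q c ('I_N * 'I_d + 'I_N)%type 'I_d 'I_N
  (fun j t => inl (t, j)) (fun j t => inr t) (fun=> 1)
  (fun j => inl (Ordinal N0, j)) (fun=> 0) (fun=> 0) T0.
rewrite !card_ord; apply: net_ext => u j.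
rewrite mul0r !addr0 mul1r mxE; apply: eq_bigr => t _; by rewrite !mxE.
Qed.

Lemma net_mulmx_r q c d : (0 < d)%N ->
  net q.+1 (fun u : 'I_d * 'I_d + 'I_d -> R => fun i : 'I_d =>
      mulmx_approx q c (of_entries (fun ij => u (inl ij))) (col_of (fun i => u (inr i))) i 0)
    (102 * q.+1 * (d * d)).
Proof.
move=> d0; have T0 : (0 < #|'I_d|)%N by rewrite card_ord.
have := @net_quadratic R q c ('I_d * 'I_d + 'I_d)%type 'I_d 'I_d
  (fun i t => inl (i, t)) (fun j t => inr t) (fun=> 1)
  (fun i => inr i) (fun=> 0) (fun=> 0) T0.
rewrite !card_ord; apply: net_ext => u j.
rewrite mul0r !addr0 mul1r mxE; apply: eq_bigr => t _; by rewrite !mxE.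
Qed.

Lemma net_gram q c t N d : (0 < N)%N ->
  net q.+1 (fun u : 'I_N * 'I_d -> R =>
      sum_case (entries (mulmx_approx q c (of_entries u)^T (of_entries u))) (entries (t%:M : 'M[R]_d)))
    (102 * q.+1 * (2 * (d * d) * N)).
Proof.
move=> N0; have T0 : (0 < #|'I_N|)%N by rewrite card_ord.
pose D2 := ('I_d * 'I_d)%type.
pose pr (x : D2 + D2) : D2 := match x with inl y => y | inr y => y end.
have := @net_quadratic R q c ('I_N * 'I_d)%type (D2 + D2)%type 'I_N
  (fun x t => (t, (pr x).1)) (fun x t => (t, (pr x).2)) (sum_case (fun=> 1) (fun=> 0))
  (fun x => (Ordinal N0, (pr x).1)) (fun=> 0) (sum_case (fun=> 0) (entries (t%:M : 'M[R]_d))) T0.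
rewrite card_sum card_prod !card_ord addnn -mul2n; apply: net_ext => u [] [i j] /=.
  rewrite mul0r !addr0 mul1r /entries mxE; apply: eq_bigr => k _; by rewrite !mxE.
by rewrite !mul0r !add0r.
Qed.

(** A Newton step needs S again in the next step, so the pair of S and X is
iterated. *)
Definition newton_state q c d (u : 'I_d * 'I_d + 'I_d * 'I_d -> R) :=
  sum_case (fun ij => u (inl ij))
      (entries (newton q c (of_entries (fun ij => u (inl ij))) (of_entries (fun ij => u (inr ij))))).

Lemma net_newton q c d : (0 < d)%N ->
  net (2 * q + 3) (@newton_state q c d)
    (1020 * q.+1 * (d * d * d)).
Proof.
move=> d0; have T0 : (0 < #|'I_d|)%N by rewrite card_ord.
pose D2 := ('I_d * 'I_d)%type.
pose pr1 (x : D2 + D2 + D2) : D2 := match x with inl (inl y) => y | inl (inr y) => y | inr y => y end.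
pose pr2 (x : D2 + D2) : D2 := match x with inl y => y | inr y => y end.
have n1 := @net_quadratic R q c (D2 + D2)%type (D2 + D2 + D2)%type 'I_d
  (fun x t => inl ((pr1 x).1, t)) (fun x t => inr (t, (pr1 x).2))
  (sum_case (fun=> 0) (fun=> 1))
  (fun x => match x with inl y => y | inr y => inl y end)
  (sum_case (fun=> 1) (fun=> 0)) (fun=> 0) T0.
have n2 := @net_quadratic R q c (D2 + D2 + D2)%type (D2 + D2)%type 'I_d
  (fun x t => inl (inr ((pr2 x).1, t))) (fun x t => inr (t, (pr2 x).2))
  (sum_case (fun=> 0) (fun=> -1)) (fun x => inl x)
  (sum_case (fun=> 1) (fun=> 2)) (fun=> 0) T0.
have J0 : (0 < #|{: D2 + D2 + D2}|)%N.
  by rewrite !card_sum !card_prod !card_ord !addn_gt0 muln_gt0 d0.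
have /net_weaken n := net_comp J0 n1 n2.
have {n} := n (1020 * q.+1 * (d * d * d))%N _.
have -> : (q.+1 + q.+1).+1 = (2 * q + 3)%N by lia.
move=> n; apply: net_ext (n _); last first.
  (* The two products have 3 d^2 and 2 d^2 outputs, each a sum of d terms. *)
  by rewrite !card_sum !card_prod !card_ord; nia.
move=> u [[i j]|[i j]]; rewrite /newton_state /=; first by rewrite !mul0r !mul1r !add0r !addr0.
rewrite /entries /newton !mxE /= !addr0 mulN1r addrC mul0r add0r mul1r.
congr (- _ + _); apply: eq_bigr => k _; rewrite !mxE !mul0r !add0r !addr0 !mul1r.
by congr mul_approx; apply: eq_bigr => l _; rewrite !mxE.
Qed.

(** In the nested concatenations the cost doubles with each step. *)
Lemma net_iter h (I : finType) (F : (I -> R) -> I -> R) M k : (0 < #|I|)%N ->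
  net h F M -> net (k * h.+1) (iter k F) (2 ^ k * (#|I| + 2 * M)).
Proof.
move=> I0 hF.
suff [n [hn hnet]] : exists n, (n + 2 * M <= 2 ^ k * (#|I| + 2 * M))%N /\
    net (k * h.+1) (iter k F) n.
  by apply: net_weaken hnet; lia.
elim: k => [|k [n [hn IH]]].
  by exists #|I|; split; [rewrite expn0; lia | exact: net_id0].
exists (2 * n + 2 * M)%N; split; first by rewrite expnS; lia.
have -> : (k.+1 * h.+1 = (k * h.+1 + h).+1)%N by lia.
exact: net_comp I0 IH hF.
Qed.

Lemma iter_newton_state q c d m (S X : 'M[R]_d) :
  iter m (@newton_state q c d) (sum_case (entries S) (entries X)) = sum_case (entries S) (entries (iter m (newton q c S) X)).
Proof.
elim: m => //= m ->; rewrite /newton_state.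
have -> : of_entries (fun ij => sum_case (entries S) (entries (iter m (newton q c S) X)) (inl ij)) = S by rewrite /= of_entriesK.
have -> : of_entries (fun ij => sum_case (entries S) (entries (iter m (newton q c S) X)) (inr ij)) = iter m (newton q c S) X by rewrite /= of_entriesK.
by [].
Qed.

(** B enters twice, because the right-hand side and the Gram matrix call for
approximations of different accuracy. *)
Definition solver q1 q2 m c t N d (B1 B3 : 'M[R]_(N, d)) (f : 'cV[R]_N) : 'cV[R]_d :=
  mulmx_approx q2 c (iter m (newton q2 c (mulmx_approx q1 c B3^T B3)) t%:M) (mulmx_approx q1 c B1^T f).

(** The left-hand side is the number of weights that the construction of
[solver_network] produces. *)
Lemma weights_budget (W1 W3 Wf h1 h3 hf N d q1 q2 m M : nat) :
  (0 < N)%N -> (0 < d)%N -> (m < M)%N ->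
  (2 * (2 * (2 * W3 + 2 * (2 * (102 * q1.+1 * (2 * (d * d) * N)) +
      2 * (M * (d * d + d * d + 2 * (1020 * q2.+1 * (d * d * d)))))) +
    4 * ((h1 + hf).+1 + q1.+1).+2 * (d * d) +
    (2 * (2 * (2 * W1 + 4 * hf.+1 * (N * d) + (2 * Wf + 4 * h1.+1 * N)) +
      2 * (102 * q1.+1 * (d * N))) +
     4 * (h3 + (q1.+1 + m * (2 * q2 + 3).+1).+1).+2 * d)) +
   2 * (102 * q2.+1 * (d * d)) <=
   16 * W1 + 16 * Wf + 8 * W3 + 32 * (N * d * hf.+1) + 32 * (N * h1.+1)
   + 8 * (d * h3.+1) + 8 * (d * d * (h1.+1 + hf.+1))
   + 33 * 1000 * (N * (d * d) * q1.+1) + 33 * 1000 * (M * q2.+1 * (d * d * d)))%N.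
Proof.
move=> N0 d0 mM.
have c1 : (d * q1.+1 <= N * (d * d) * q1.+1)%N by rewrite leq_mul2r; nia.
have c2 : (d * d * q1.+1 <= N * (d * d) * q1.+1)%N by rewrite leq_mul2r; nia.
have c3 : (N * d * q1.+1 <= N * (d * d) * q1.+1)%N by rewrite leq_mul2r; nia.
have e1 : (d * d <= d * d * d)%N by nia.
have e2 : (d <= d * d * d)%N by nia.
have c4 : (m * q2.+1 * d <= M * q2.+1 * (d * d * d))%N.
  by apply: leq_mul => //; rewrite leq_mul2r; lia.
have c5 : (M * 1 * (d * d) <= M * q2.+1 * (d * d * d))%N.
  by apply: leq_mul => //; apply: leq_mul.
have c6 : (1 * q2.+1 * (d * d) <= M * q2.+1 * (d * d * d))%N.
  by apply: leq_mul => //; rewrite leq_mul2r; lia.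
have c7 : (m * d <= m * q2.+1 * d)%N by rewrite leq_mul2r -[X in (X <= _)%N]muln1 leq_mul2l; lia.
have c8 : (d <= d * q1.+1)%N by rewrite leq_pmulr.
have c9 : (d * d <= d * d * q1.+1)%N by rewrite leq_pmulr.
lia.
Qed.

(** The right-hand side B^T f and the approximate inverse are computed side by
side.  Before they are multiplied, each waits for the depth of the other: this
costs d weights per layer for the right-hand side and d^2 for the inverse, which
keeps the depth L3 away from the product N d. *)
Lemma solver_network : exists2 C : nat, (0 < C)%N &
  forall p N d q1 q2 m c t (Psi1 Psi3 : network R p (d * N)) (Psif : network R p N),
  (0 < N)%N -> (0 < d)%N ->
  let L1 := layers Psi1 in let L3 := layers Psi3 in let Lf := layers Psif in
  exists Phi : network R p d,
  [/\ layers Phi = (L1 + L3 + Lf + 2 * q1 + q2 + m * (2 * q2 + 4) + 7)%N,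
      (weights Phi <= 16 * weights Psi1 + 16 * weights Psif + 8 * weights Psi3
         + 32 * (N * d * Lf) + 32 * (N * L1) + 8 * (d * L3) + 8 * (d * d * (L1 + Lf))
         + C * (N * (d * d) * q1.+1) + C * (2 ^ m * q2.+1 * (d * d * d)))%N &
      forall x, realization Phi x =
        solver q1 q2 m c t (matr (realization Psi1 x)) (matr (realization Psi3 x))
          (realization Psif x)].
Proof.
exists (33 * 1000)%N => // p N d q1 q2 m c t Psi1 Psi3 Psif.
move=> N0 d0 L1 L3 Lf.
have LS n k (Psi : network R n k) : layers Psi = (layers Psi).-1.+1 by case: Psi.
have [h1 E1] : exists h, L1 = h.+1 by exists L1.-1; exact: LS.
have [h3 E3] : exists h, L3 = h.+1 by exists L3.-1; exact: LS.
have [hf Ef] : exists h, Lf = h.+1 by exists Lf.-1; exact: LS.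
have n1 : net h1 _ _ := net_matr (congr1 predn E1).
have n3 : net h3 _ _ := net_matr (congr1 predn E3).
have nf := net_of_network Psif; rewrite -/Lf Ef /= in nf.
have cN : (0 < #|'I_N|)%N by rewrite card_ord.
have cd : (0 < #|'I_d|)%N by rewrite card_ord.
have cB : (0 < #|{: 'I_N * 'I_d}|)%N by rewrite card_prod !card_ord muln_gt0 N0.
have cD : (0 < #|{: 'I_d * 'I_d}|)%N by rewrite card_prod !card_ord muln_gt0 d0.
have cBN : (0 < #|{: 'I_N * 'I_d + 'I_N}|)%N by exact: card_sum_gt0.
have cDD : (0 < #|{: 'I_d * 'I_d + 'I_d * 'I_d}|)%N by exact: card_sum_gt0.
have cDd : (0 < #|{: 'I_d * 'I_d + 'I_d}|)%N by exact: card_sum_gt0.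
(* Padding each network by the depth of the other one avoids the maximum of the
   two depths, and the sum L1 + Lf is affordable in the final bound. *)
have p1 := net_pad hf cB n1; have pf := net_pad h1 cN nf.
rewrite (addnC hf h1) in pf.
have rhs := net_comp cBN (net_par p1 pf) (net_mulmx_l q1 c d N0).
have inrI : injective (fun ij : 'I_d * 'I_d => inr ij : 'I_d * 'I_d + 'I_d * 'I_d).
  by move=> x y [].
have inv := net_reindex_output inrI (net_comp cDD (net_gram q1 c t d N0)
   (net_iter m cDD (net_newton q2 c d0))).
have mat := net_comp cB n3 inv.
set H1 := (_.+1 + q1.+1).+1 in rhs.
set H2 := (h3 + _).+1 in mat.
have b1 := net_pad H2 cd rhs; have b2 := net_pad H1 cD mat.
rewrite (addnC H1 H2) in b1.
have full := net_comp cDd (net_par b2 b1) (net_mulmx_r q2 c d0).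
have [Phi [hL hW hR]] := network_of_net full.
exists Phi; split.
- rewrite hL E1 E3 Ef /H1 /H2; lia.
- apply: leq_trans hW _; rewrite /H1 /H2 E1 E3 Ef.
  rewrite !card_sum !card_prod !card_ord.
  by apply: weights_budget => //; exact: ltn_expl.
- move=> x; apply/matrixP => i j; rewrite (ord1 j) hR /=.
  rewrite /solver; congr (mulmx_approx _ _ _ _ i 0).
    by rewrite iter_newton_state /= of_entriesK of_entriesK col_ofK.
  apply/matrixP => k l; rewrite (ord1 l) mxE.
  congr (mulmx_approx q1 c _^T _ k 0); first by rewrite -[RHS]of_entriesK col_ofK.
  by rewrite col_ofK; congr realization; exact: col_ofK.
Qed.
End Assembly.

(** * Rates in terms of the accuracy, and the theorem *)

Section Rates.
Variable R : realType.
Implicit Types x y : R.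

Lemma ln2_gt0 : 0 < ln 2 :> R.
Proof. by rewrite ln_gt0 // ltr1n. Qed.

Lemma log2M x y : 0 < x -> 0 < y -> log2 (x * y) = log2 x + log2 y.
Proof. by move=> x0 y0; rewrite /log2 lnM ?posrE // mulrDl. Qed.

Lemma log2X x n : 0 < x -> log2 (x ^+ n) = n%:R * log2 x.
Proof. by move=> x0; rewrite /log2 lnXn // -[ln x *+ n]mulr_natl mulrA. Qed.

Lemma log2_ge0 x : 1 <= x -> 0 <= log2 x.
Proof. by move=> x1; rewrite divr_ge0 ?ln_ge0 ?ler1n. Qed.

Lemma log2_le x y : 0 < x -> x <= y -> log2 x <= log2 y.
Proof.
move=> x0 xy; rewrite /log2 ler_pM2r ?invr_gt0 ?ln2_gt0 //.
by rewrite ler_ln ?posrE // (lt_le_trans x0).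
Qed.

Lemma log2_2 : log2 2 = 1 :> R.
Proof. by rewrite /log2 divff // gt_eqF // ln2_gt0. Qed.

Lemma log2_inv_ge2 (e : R) : 0 < e -> e < 1 / 4 -> 2 <= log2 (1 / e) /\ 4 < 1 / e.
Proof.
move=> e0 e4; have ie : 4 < 1 / e by rewrite ltr_pdivlMr //; lra.
split => //; have <- : log2 4 = 2 :> R.
  by rewrite (_ : 4 = 2 ^+ 2 :> R) ?log2X ?log2_2 ?mulr1 // -natrX.
by apply: log2_le => //; exact: ltW.
Qed.

Lemma pow2_between y : 1 <= y ->
  exists q : nat, [/\ y <= 2 ^+ q, 2 ^+ q <= 2 * y & q%:R <= log2 y + 1].
Proof.
move=> y1; have y0 : 0 < y by lra.
have l0 := log2_ge0 y1.
have l2 : log2 y * ln 2 = ln y by rewrite divfK // gt_eqF // ln2_gt0.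
have e2 n : 2 ^+ n = sequences.expR (n%:R * ln 2) :> R by rewrite expRM_natl lnK // posrE.
have /andP[tl tu] := truncn_itv l0.
exists (Num.truncn (log2 y)).+1; split.
- by rewrite -[leLHS](lnK y0) e2 ler_expR -l2 ler_pM2r ?ln2_gt0 // ltW.
- rewrite exprS ler_pM2l // -[leRHS](lnK y0) e2 ler_expR -l2 ler_pM2r //.
  exact: ln2_gt0.
- by rewrite -natr1 lerD2r.
Qed.

(** As c n^k / e^j is at most a power of 2 with exponent of order
log2(1/e) + log2 n, and 2^q <= 4^q. *)
Lemma accuracy_steps (c : R) (n k j : nat) (e : R) :
  0 <= c -> (0 < n)%N -> (k <= 3)%N -> (j <= 2)%N -> (0 < j)%N -> 0 < e < 1 / 4 ->
  let l := log2 (1 / e) in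
  exists q : nat, n%:R ^+ k * c * 4^-1 ^+ q <= e ^+ j /\
    q.+1%:R <= (log2 (1 + c) + 5) * (l + log2 n%:R).
Proof.
move=> c0 n0 k3 j2 j0 /andP[e0 e4] l.
have n1 : 1 <= n%:R :> R by rewrite ler1n.
have L0 := log2_ge0 n1.
have [l2 ie] := log2_inv_ge2 e0 e4.
rewrite -/l in l2.
have nk : 1 <= n%:R ^+ k :> R by rewrite exprn_ege1.
have ij : 1 <= (1 / e) ^+ j by rewrite exprn_ege1 //; lra.
have c1 : 1 <= 1 + c by lra.
have C0 := log2_ge0 c1.
have nc1 : 1 <= n%:R ^+ k * (1 + c) by apply: mulr_ege1.
have [q [q1 _ q3]] : exists q : nat, [/\ n%:R ^+ k * (1 + c) * (1 / e) ^+ j <= 2 ^+ q,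
    2 ^+ q <= 2 * (n%:R ^+ k * (1 + c) * (1 / e) ^+ j) &
    q%:R <= log2 (n%:R ^+ k * (1 + c) * (1 / e) ^+ j) + 1].
  by apply: pow2_between; exact: mulr_ege1.
exists q; split.
  have q4 : 2 ^+ q <= 4 ^+ q :> R by rewrite lerXn2r ?nnegrE // ler_nat.
  have p4 : 0 < 4 ^+ q :> R by rewrite exprn_gt0.
  rewrite exprVn ler_pdivrMr // -ler_pdivrMl ?exprn_gt0 //.
  apply: le_trans q4; apply: le_trans q1.
  rewrite mulrC div1r exprVn ler_pM2r ?invr_gt0 ?exprn_gt0 //.
  by rewrite ler_pM2l ?exprn_gt0 ?ltr0n // lerDr.
rewrite -natr1; move: q3; rewrite !log2M ?log2X ?mulr_gt0 ?exprn_gt0 ?ltr0n //; try lra.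
rewrite -/l => q3.
have k3' : k%:R <= 3 :> R by rewrite ler_nat.
have j2' : j%:R <= 2 :> R by rewrite ler_nat.
nra.
Qed.

(** (1 - g)^(2^m) is at most e / t once 2^m is a suitable multiple of
log2(1/e); choosing 2^m within a factor 2 of it bounds both 2^m and m. *)
Lemma newton_steps (g t : R) (hg : 0 < g) (hg1 : g < 1) (ht : 1 <= t) :
  exists K : R, 0 < K /\ forall e : R, 0 < e < 1 / 4 ->
  let l := log2 (1 / e) in
  exists m : nat, [/\ (1 - g) ^+ (2 ^ m) * t <= e, m%:R <= K * log2 l &
    (2 ^ m)%:R <= K * l].
Proof.
set s := - ln (1 - g).
have s0 : 0 < s by rewrite /s oppr_gt0 ln_lt0 //; lra.
have t0 : 0 < t by lra.
have lt0 := ln_ge0 ht; have ln20 := ln2_gt0.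
pose K0 : R := 1 + (ln t + ln 2) / s.
have K01 : 1 <= K0 by rewrite /K0 lerDl divr_ge0 ?addr_ge0 // ltW.
have C0 := log2_ge0 K01.
exists (log2 K0 + 2 + 2 * K0); split; first lra.
move=> e /andP[e0 e4] l.
have [l2 ie] := log2_inv_ge2 e0 e4.
rewrite -/l in l2.
have ll1 : 1 <= log2 l by rewrite -log2_2; apply: log2_le.
have Kl : 1 <= K0 * l by apply: mulr_ege1; lra.
have [m [m1 m2 m3]] := pow2_between Kl.
exists m; split.
- have g1 : 0 < 1 - g by lra.
  rewrite -ler_pdivlMr // -(@ler_ln _ _ _) ?posrE ?exprn_gt0 ?divr_gt0 //.
  rewrite lnXn // ln_div ?posrE // -[_ *+ _]mulr_natr.
  have le : ln e = - (l * ln 2).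
    by rewrite /l /log2 divfK ?gt_eqF // div1r lnV ?posrE // opprK.
  have ks : K0 * l * s = l * s + (ln t + ln 2) * l.
    by rewrite /K0; field; rewrite gt_eqF.
  have : K0 * l * s <= (2 ^ m)%:R * s by rewrite ler_pM2r // natrX.
  rewrite ks le -[ln (1 - g)]opprK -/s.
  have : ln t <= ln t * l by rewrite ler_peMr //; lra.
  have : 0 <= l * s by rewrite mulr_ge0 ?ltW //; lra.
  nra.
- apply: le_trans m3 _; rewrite log2M; try lra.
  nra.
- rewrite natrX; apply: le_trans m2 _; nra.
Qed.

End Rates.

Section Tolerances.
Variables (R : realType) (alpha beta gamma e : R).
Hypotheses (a0 : 0 < alpha) (b0 : 0 < beta) (g0 : 0 < gamma) (e0 : 0 < e).

Lemma eps1_bounds : let t := eps1 alpha beta gamma e in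
  [/\ 0 < t, t * gamma <= e * beta ^+ 2 / 12, t <= beta * Num.sqrt e / 4 & t <= alpha / 4].
Proof.
move=> t; have s0 : 0 < Num.sqrt e by rewrite sqrtr_gt0.
have s1 : 0 < Num.sqrt (alpha * gamma) by rewrite sqrtr_gt0 mulr_gt0.
split.
- by rewrite /t /eps1 !lt_min !divr_gt0 // ?mulr_gt0 // exprn_gt0.
- have : t <= e * beta ^+ 2 / (12 * gamma) by rewrite /t /eps1 ge_min lexx.
  rewrite -(ler_pM2r g0) => /le_trans; apply.
  by rewrite le_eqVlt; apply/orP; left; apply/eqP; field; rewrite gt_eqF.
- by rewrite /t /eps1 !ge_min lexx ?orbT.
- by rewrite /t /eps1 !ge_min lexx ?orbT.
Qed.

Lemma eps2_bounds : let t := eps2 alpha beta gamma e in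
  [/\ 0 < t, alpha * t <= e * beta ^+ 2 / 12, t <= beta * Num.sqrt e / 4 & t <= gamma / 4].
Proof.
move=> t; have s0 : 0 < Num.sqrt e by rewrite sqrtr_gt0.
have s1 : 0 < Num.sqrt (alpha * gamma) by rewrite sqrtr_gt0 mulr_gt0.
split.
- by rewrite /t /eps2 !lt_min !divr_gt0 // ?mulr_gt0 // exprn_gt0.
- have : t <= e * beta ^+ 2 / (12 * alpha) by rewrite /t /eps2 ge_min lexx.
  rewrite -(ler_pM2l a0) => /le_trans; apply.
  by rewrite le_eqVlt; apply/orP; left; apply/eqP; field; rewrite gt_eqF.
- by rewrite /t /eps2 !ge_min lexx ?orbT.
- by rewrite /t /eps2 !ge_min lexx ?orbT.
Qed.

Lemma eps12_bound :
  eps1 alpha beta gamma e * eps2 alpha beta gamma e <= beta ^+ 2 * e / 16.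
Proof.
have [t0 _ t1 _] := eps1_bounds; have [u0 _ u1 _] := eps2_bounds.
apply: le_trans (ler_pM (ltW t0) (ltW u0) t1 u1) _.
rewrite -[in leRHS](sqr_sqrtr (ltW e0)).
by rewrite le_eqVlt; apply/orP; left; apply/eqP; field.
Qed.

Lemma eps3_bounds : let t := eps3 alpha beta gamma e in
  [/\ 0 < t, t <= beta / 3, 2 * alpha * t + t ^+ 2 <= 5 / 18 * beta ^+ 2 &
   (2 * alpha * t + t ^+ 2) * (alpha * gamma) <= 7 / 288 * e * (beta ^+ 2) ^+ 2].
Proof.
move=> t; have ag : 0 < alpha * gamma by rewrite mulr_gt0.
have age : 0 < 6 * alpha * gamma * e by rewrite !mulr_gt0.
have s1 : 0 < Num.sqrt (6 * alpha * gamma * e) by rewrite sqrtr_gt0.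
have t0 : 0 < t.
  by rewrite /t /eps3 !lt_min !divr_gt0 // ?mulr_gt0 // exprn_gt0.
have h1 : t <= e * beta ^+ 4 / (144 * alpha ^+ 2 * gamma) by rewrite /t /eps3 ge_min lexx.
have h2 : t <= beta ^+ 2 * Num.sqrt (6 * alpha * gamma * e) / (24 * alpha * gamma).
  by rewrite /t /eps3 !ge_min lexx ?orbT.
have h3 : t <= beta ^+ 2 / (12 * alpha) by rewrite /t /eps3 !ge_min lexx ?orbT.
have h4 : t <= beta / 3 by rewrite /t /eps3 !ge_min lexx ?orbT.
clearbody t.
have k1 : 2 * alpha * t * (alpha * gamma) <= e * (beta ^+ 2) ^+ 2 / 72.
  have p0 : 0 < 2 * alpha * (alpha * gamma) by rewrite !mulr_gt0.
  have := ler_wpM2l (ltW p0) h1.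
  have -> : 2 * alpha * (alpha * gamma) * (e * beta ^+ 4 / (144 * alpha ^+ 2 * gamma)) =
    e * (beta ^+ 2) ^+ 2 / 72 by field; rewrite !gt_eqF.
  by rewrite -!mulrA [t * _]mulrC -!mulrA.
have k2 : t ^+ 2 * (alpha * gamma) <= e * (beta ^+ 2) ^+ 2 / 96.
  have : t ^+ 2 <= (beta ^+ 2 * Num.sqrt (6 * alpha * gamma * e) / (24 * alpha * gamma)) ^+ 2.
    by rewrite ler_pXn2r // nnegrE ltW // (lt_le_trans t0).
  move/(ler_wpM2r (ltW ag))/le_trans; apply.
  rewrite expr_div_n exprMn (sqr_sqrtr (ltW age)) le_eqVlt; apply/orP; left; apply/eqP.
  by field; rewrite !gt_eqF.
have k3 : 2 * alpha * t <= beta ^+ 2 / 6.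
  have := ler_wpM2l (ltW a0) h3.
  have -> : alpha * (beta ^+ 2 / (12 * alpha)) = beta ^+ 2 / 12 by field; rewrite gt_eqF.
  lra.
have k4 : t ^+ 2 <= beta ^+ 2 / 9.
  have : t ^+ 2 <= (beta / 3) ^+ 2 by rewrite ler_pXn2r // nnegrE ltW // (lt_le_trans t0).
  rewrite expr_div_n; lra.
split => //; first lra.
rewrite mulrDl; lra.
Qed.

End Tolerances.

(** Constants and single logarithms are absorbed by
log2(log2(1/e)) (log2(1/e) + log2 d), both factors being at least 1. *)
Lemma layers_budget (R : realType) (L1 L3 Lf q1 q2 m : nat) (a1 a2 a3 l ll Ln Ld : R) :
  2 <= l -> 1 <= ll -> 0 <= Ln -> 0 <= Ld -> 0 <= a1 -> 0 <= a2 -> 0 <= a3 ->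
  q1.+1%:R <= a1 * (l + Ln) -> q2.+1%:R <= a2 * (l + Ld) -> m%:R <= a3 * ll ->
  (L1 + L3 + Lf + 2 * q1 + q2 + m * (2 * q2 + 4) + 7)%N%:R <=
  (2 * a1 + a2 * (1 + 4 * a3) + 3) * ll * (l + Ld)
  + (2 * a1 + a2 * (1 + 4 * a3) + 3) * Ln + L1%:R + L3%:R + Lf%:R.
Proof.
move=> l2 ll1 Ln0 Ld0 a10 a20 a30 h1 h2 h3.
have hm : 0 <= m%:R :> R by exact: ler0n.
have hq : 0 <= q2.+1%:R :> R by exact: ler0n.
pose T := (2 * q1 + q2 + m * (2 * q2 + 4) + 7)%N.
have -> : (L1 + L3 + Lf + 2 * q1 + q2 + m * (2 * q2 + 4) + 7 = L1 + L3 + Lf + T)%N.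
  by rewrite /T !addnA.
have hT : T%:R <= 2 * q1.+1%:R + q2.+1%:R + 4 * (m%:R * q2.+1%:R) + 4 :> R.
  rewrite -!natrM -!natrD ler_nat /T mulnDr mulnS mulnCA.
  by clear; lia.
clearbody T; rewrite !natrD; move: (T%:R) hT => {}T hT.
set W := ll * (l + Ld).
have lW : l <= W by rewrite /W; nra.
have lW' : l + Ld <= W by rewrite /W; nra.
have q2W : q2.+1%:R <= a2 * W by apply: le_trans h2 _; rewrite ler_wpM2l.
have mqW : m%:R * q2.+1%:R <= a3 * a2 * W.
  apply: le_trans (ler_pM hm hq h3 h2) _; rewrite /W; lra.
have q1W : q1.+1%:R <= a1 * W + a1 * Ln by apply: le_trans h1 _; rewrite mulrDr lerD2r ler_wpM2l.
have c0 : 0 <= a2 * (1 + 4 * a3) + 3 by rewrite addr_ge0 // mulr_ge0 // addr_ge0 // mulr_ge0.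
have LnC : 0 <= (a2 * (1 + 4 * a3) + 3) * Ln by rewrite mulr_ge0.
suff : T <= (2 * a1 + a2 * (1 + 4 * a3) + 3) * W + (2 * a1 + a2 * (1 + 4 * a3) + 3) * Ln.
  rewrite /W mulrA; lra.
apply: le_trans hT _; lra.
Qed.

(** As d <= N, the d^2 weights per layer spent while the inverse waits for the
right-hand side are covered by the terms in N d. *)
Lemma weights_rate (R : realType) (W1 W3 Wf L1 L3 Lf N d q1 q2 M w c : nat)
    (a1 a2 a4 l ll Ln Ld : R) :
  let C := c%:R * (a1 + a4 * a2) in
  let n : R := N%:R in let k : R := d%:R in
  (0 < N)%N -> (0 < d)%N -> (d <= N)%N ->
  2 <= l -> 1 <= ll -> 0 <= Ln -> 0 <= Ld -> 0 <= a1 -> 0 <= a2 -> 0 <= a4 ->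
  q1.+1%:R <= a1 * (l + Ln) -> q2.+1%:R <= a2 * (l + Ld) -> M%:R <= a4 * l ->
  (w <= 16 * W1 + 16 * Wf + 8 * W3
         + 32 * (N * d * Lf) + 32 * (N * L1) + 8 * (d * L3) + 8 * (d * d * (L1 + Lf))
         + c * (N * (d * d) * q1.+1) + c * (M * q2.+1 * (d * d * d)))%N ->
  w%:R <= C * n * k ^+ 2 * (l + Ln) + C * k ^+ 2 * l * (ll + k) * (l + Ld)
      + C * k ^+ 2 * ll * Ln
      + 16 * W1%:R + 16 * Wf%:R + 8 * W3%:R
      + 80 * n * k * L1%:R + 80 * n * k * Lf%:R + 16 * k ^+ 2 * L3%:R.
Proof.
move=> C n k N0 d0 dN l2 ll1 Ln0 Ld0 a10 a20 a40 h1 h2 h3 hw.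
have up : (w <= 16 * W1 + 16 * Wf + 8 * W3 + 80 * (N * d * L1) + 80 * (N * d * Lf)
    + 16 * (d * d * L3) + c * (N * (d * d) * q1.+1)
    + c * (M * q2.+1 * (d * d * d)))%N.
  apply: leq_trans hw _.
  have i1 : (N * L1 <= N * d * L1)%N by rewrite leq_mul2r leq_pmulr // orbT.
  have i2 : (d * L3 <= d * d * L3)%N by rewrite leq_mul2r leq_pmulr // orbT.
  have i3 : (d * d * L1 <= N * d * L1)%N by rewrite leq_mul2r leq_mul2r dN !orbT.
  have i4 : (d * d * Lf <= N * d * Lf)%N by rewrite leq_mul2r leq_mul2r dN !orbT.
  lia.
have : w%:R <= 16 * W1%:R + 16 * Wf%:R + 8 * W3%:R + 80 * (n * k * L1%:R) + 80 * (n * k * Lf%:R)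
    + 16 * (k * k * L3%:R) + c%:R * (n * (k * k) * q1.+1%:R)
    + c%:R * (M%:R * q2.+1%:R * (k * k * k)) :> R.
  by rewrite /n /k -!natrM -!natrD ler_nat.
move/le_trans; apply.
have n0 : 0 <= n by exact: ler0n.
have k0 : 0 <= k by exact: ler0n.
have C0 : 0 <= C by apply: mulr_ge0; rewrite ?ler0n ?addr_ge0 ?mulr_ge0.
have c10 : 0 <= c%:R :> R by exact: ler0n.
have l0 : 0 <= l by lra.
have lL : 0 <= l + Ln by lra.
have lL' : 0 <= l + Ld by lra.
have ll0 : 0 <= ll by lra.
have t1 : c%:R * (n * (k * k) * q1.+1%:R) <= C * n * k ^+ 2 * (l + Ln).
  have nk0 : 0 <= n * (k * k) by rewrite !mulr_ge0.
  have i1 := ler_wpM2l c10 (ler_wpM2l nk0 h1).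
  have i2 : 0 <= c%:R * (a4 * a2) * (n * (k * k) * (l + Ln)) by rewrite !mulr_ge0.
  by apply: le_trans i1 _; rewrite -subr_ge0; apply: le_trans i2 _; rewrite le_eqVlt; apply/orP; left; apply/eqP; rewrite /C; ring.
have t2 : c%:R * (M%:R * q2.+1%:R * (k * k * k)) <= C * k ^+ 2 * l * (ll + k) * (l + Ld).
  have kkk0 : 0 <= k * k * k by rewrite !mulr_ge0.
  have i1 := ler_wpM2l c10 (ler_wpM2r kkk0 (ler_pM (ler0n _ _) (ler0n _ _) h3 h2)).
  have i2 : 0 <= C * ((k * k) * l * ll * (l + Ld)) by apply: mulr_ge0 => //; rewrite !mulr_ge0.
  have i3 : 0 <= c%:R * a1 * ((k * k * k) * l * (l + Ld)) by rewrite !mulr_ge0.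
  by apply: le_trans i1 _; rewrite -subr_ge0; apply: le_trans (addr_ge0 i2 i3) _; rewrite le_eqVlt; apply/orP; left; apply/eqP; rewrite /C; ring.
have t3 : 0 <= C * k ^+ 2 * ll * Ln.
  by do 2!apply: mulr_ge0 => //; apply: mulr_ge0 => //; exact: sqr_ge0.
move: t1 t2 t3; rewrite !expr2; lra.
Qed.

Theorem theorem1 (R : realType) (alpha beta gamma : R)
    (halpha : 0 < alpha) (hbeta : 0 < beta) (hgamma : 0 < gamma)
    (hbeta2 : 0 < beta ^+ 2) (hba : beta ^+ 2 < alpha ^+ 2) :
  exists CL CM : R, 0 < CL /\ 0 < CM /\
  forall (p N d : nat), (0 < p)%N -> (0 < N)%N -> (0 < d)%N ->
  forall (D : set 'cV[R]_p) (A : 'cV[R]_p -> 'M[R]_N)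
    (fg : 'cV[R]_p -> 'cV[R]_N) (VV : set 'M[R]_(N, d))
    (PhiB : 'M[R]_(N, d) -> R -> network R p (d * N))
    (Phifg : R -> network R p N),
  (forall V, VV V -> orthogonal_system V) ->
  assumption1 alpha beta gamma D A fg VV ->
  assumption2 D A VV PhiB ->
  assumption3 D fg Phifg ->
  forall (e : R) (V : 'M[R]_(N, d)), 0 < e < 1 / 4 -> VV V ->
  let e1 := eps1 alpha beta gamma e in
  let e2 := eps2 alpha beta gamma e in
  let e3 := eps3 alpha beta gamma e in
  let LB (t : R) : R := (layers (PhiB V t))%:R in
  let MB (t : R) : R := (weights (PhiB V t))%:R in
  let Lfg (t : R) : R := (layers (Phifg t))%:R in
  let Mfg (t : R) : R := (weights (Phifg t))%:R in
  let n : R := N%:R in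
  let k : R := d%:R in
  let l : R := log2 (1 / e) in
  exists Phi : network R p d,
    [/\ (ereal_sup [set (norm2 (cvec A fg V mu - realization Phi mu))%:E
                   | mu in D] <= e%:E)%E,
        (layers Phi)%:R <=
          CL * log2 l * (l + log2 k) + CL * log2 n + LB e1 + LB e3 + Lfg e2
      & (weights Phi)%:R <=
          CM * n * k ^+ 2 * (l + log2 n)
          + CM * k ^+ 2 * l * (log2 l + k) * (l + log2 k)
          + CM * k ^+ 2 * log2 l * log2 n
          + 16 * MB e1 + 16 * Mfg e2 + 8 * MB e3
          + 80 * n * k * LB e1 + 80 * n * k * Lfg e2 + 16 * k ^+ 2 * LB e3].
Proof.
have A20 : 0 < alpha ^+ 2 by rewrite exprn_gt0.
have ag0 : 0 < alpha * gamma by rewrite mulr_gt0.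
have gap0 : 0 < gap alpha beta by rewrite /gap !divr_gt0.
have gap1 : gap alpha beta < 1.
  by rewrite /gap ltr_pdivrMr // mul1r ltr_pdivrMr //; lra.
have tol2_1 : 1 <= tol2 alpha beta gamma.
  by rewrite /tol2 lerDl divr_ge0 ?mulr_ge0 // ltW.
have box0 : 0 <= entry_range alpha beta gamma.
  by rewrite /entry_range !addr_ge0 ?divr_ge0 ?mulr_ge0 // ltW.
have B40 : 0 < beta ^+ 4 by rewrite exprn_gt0.
have tol1_0 : 0 <= tol1 alpha beta gamma.
  by apply: ltW; rewrite /tol1 !(addr_gt0, mulr_gt0, divr_gt0) ?invr_gt0 ?exprn_gt0.
have tol3_0 : 0 <= tol3 alpha beta gamma.
  rewrite /tol3 addr_ge0 // divr_ge0 ?(ltW gap0) //.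
  apply: mulr_ge0; last exact: sqr_ge0.
  apply: mulr_ge0; first exact: sqr_ge0.
  by rewrite addr_ge0 ?mulr_ge0 // ltW.
have [C C0 solverP] := solver_network R.
have [K [K0 hK]] := newton_steps gap0 gap1 tol2_1.
set c := entry_range alpha beta gamma in box0.
have k1_0 : 0 <= 2 * c ^+ 2 * tol1 alpha beta gamma by rewrite !mulr_ge0 // sqr_ge0.
have k3_0 : 0 <= 2 * c ^+ 2 * tol3 alpha beta gamma by rewrite !mulr_ge0 // sqr_ge0.
pose a1 := log2 (1 + 2 * c ^+ 2 * tol1 alpha beta gamma) + 5.
pose a2 := log2 (1 + 2 * c ^+ 2 * tol3 alpha beta gamma) + 5.
have a10 : 0 < a1 by rewrite ltr_wpDl // log2_ge0 // lerDl.
have a20 : 0 < a2 by rewrite ltr_wpDl // log2_ge0 // lerDl.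
exists (2 * a1 + a2 * (1 + 4 * K) + 3).
exists (C%:R * (a1 + K * a2)).
have CL1 : 1 <= 2 * a1 + a2 * (1 + 4 * K) + 3.
  have : 0 < a2 * (1 + 4 * K) by rewrite mulr_gt0 // addr_gt0 // mulr_gt0.
  lra.
have CM0 : 0 < C%:R * (a1 + K * a2).
  by rewrite mulr_gt0 ?ltr0n // addr_gt0 // mulr_gt0.
split; first lra.
split=> // p N d p0 N0 d0 D A fg VV PhiB Phifg _ [h1s h1f] h2 h3 e V he hV.
move=> e1 e2 e3 LB MB Lfg Mfg n k l.
case/andP: (he) => e0 e4.
have n1 : 1 <= n by rewrite /n ler1n.
have k1 : 1 <= k by rewrite /k ler1n.
have Ln := log2_ge0 n1; have Lk := log2_ge0 k1.
have [l2 _] := log2_inv_ge2 e0 e4.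
rewrite -/l in l2.
have ll1 : 1 <= log2 l by rewrite -(log2_2 R); apply: log2_le.
(* The inequality d <= N, hence the size of the solver, is only available when
   there is a parameter; for an empty D the zero network does. *)
have [D0|/set0P [mu0 Dmu0]] := eqVneq D set0.
  have z0 r s : nnz (0 : 'M[R]_(r, s)) = 0%N.
    by rewrite /nnz big1 // => i _; rewrite big1 // => j _; rewrite mxE eqxx.
  exists (OutputLayer 0 0); rewrite /= !z0 addn0; split.
  - by rewrite D0 image_set0 ereal_sup0 leNye.
  - have h : 1 <= (2 * a1 + a2 * (1 + 4 * K) + 3) * log2 l * (l + log2 k).
      by apply: mulr_ege1; [exact: mulr_ege1 | lra].
    apply: le_trans h _; rewrite -!addrA lerDl; apply: addr_ge0; last first.
      by rewrite /LB /Lfg -!natrD ler0n.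
    apply: mulr_ge0 => //; lra.
  - have CMp := ltW CM0; have ln0 : 0 <= l + log2 n by lra.
    have lk0 : 0 <= l + log2 k by lra.
    have l0 : 0 <= l by lra.
    have ll0 : 0 <= log2 l by lra.
    have llk0 : 0 <= log2 l + k by lra.
    have n0 : 0 <= n by lra.
    have k0 : 0 <= k ^+ 2 by exact: sqr_ge0.
    rewrite /LB /MB /Lfg /Mfg.
    by repeat (first [assumption | exact: ler0n | apply: addr_ge0 | apply: mulr_ge0]); lra.
have [q1 [hq1 nq1]] := accuracy_steps k1_0 N0 (leqnn 3) (isT : (1 <= 2)%N) (isT : (0 < 1)%N) he.
have [q2 [hq2 nq2]] := accuracy_steps k3_0 d0 (leqnn 3) (leqnn 2) (isT : (0 < 2)%N) he.
have [m [hm nm nM]] := hK e he.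
have [e10 e1g e1s e1a] := eps1_bounds halpha hbeta hgamma e0.
have [e20 e2g e2s e2a] := eps2_bounds halpha hbeta hgamma e0.
have [e30 e3b e3s e3a] := eps3_bounds halpha hbeta hgamma e0.
have e12 := eps12_bound halpha hbeta hgamma e0.
have sup_le (T : set 'cV[R]_p) (F : 'cV[R]_p -> R) r mu :
    (ereal_sup [set (F mu)%:E | mu in T] <= r%:E)%E -> T mu -> F mu <= r.
  move=> hs Tmu; rewrite -lee_fin; apply: le_trans hs.
  by apply: ereal_sup_ubound; exists mu.
have gram_of mu : D mu -> spectrum ((Bmat A V mu)^T *m Bmat A V mu)
    `<=` `[beta ^+ 2, alpha ^+ 2]%classic by move=> Dmu; exact: h1s.
have dN : (d <= N)%N.
  by have [_ _ _ _] := gram_bounds A20 hbeta2 hba (gram_of _ Dmu0).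
have [Phi [hL hW hR]] := solverP p N d q1 q2 m c (alpha ^+ 2)^-1
  (PhiB V e1) (PhiB V e3) (Phifg e2) N0 d0.
exists Phi; split.
- apply: ge_ereal_sup => _ [mu Dmu <-]; rewrite lee_fin hR.
  apply: (@solve_error R q1 q2 m N d _ _ _ _ _ alpha beta gamma e e1 e2 e3) => //.
  - by rewrite e0 /=; lra.
  - exact: gram_of.
  - exact: h1f.
  - exact/mxnorm2_opnorm_le/(sup_le _ _ _ _ (h2 _ _ e10 hV) Dmu).
  - exact: (sup_le _ _ _ _ (h3 _ e20) Dmu).
  - exact/mxnorm2_opnorm_le/(sup_le _ _ _ _ (h2 _ _ e30 hV) Dmu).
  - by rewrite (ltW e10).
  - by rewrite (ltW e20).
  - by rewrite (ltW e30).
  - apply: le_trans hq1.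
    by rewrite -/c le_eqVlt; apply/orP; left; apply/eqP; ring.
  - apply: le_trans hq2.
    by rewrite -/c le_eqVlt; apply/orP; left; apply/eqP; ring.
- rewrite hL; exact: layers_budget l2 ll1 Ln Lk (ltW a10) (ltW a20) (ltW K0) nq1 nq2 nm.
- exact: weights_rate N0 d0 dN l2 ll1 Ln Lk (ltW a10) (ltW a20) (ltW K0) nq1 nq2 nM hW.
Qed.
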